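(* Consider minimizing $f(x)=\mathbb{E}_{z\sim P}[\tilde f(x,z)]$ over $\mathcal{K}\subseteq\mathbb{R}^d$, where $\mathcal{K}$ is convex and compact with diameter $D=\sup_{x,y\in\mathcal{K}}\|x-y\|$, and where for all $z\in\mathbb{R}^q$ the function $\tilde f(\cdot,z)$ is convex and $L$-smooth on $\mathcal{K}$, $\nabla\tilde f(x,z)$ is an unbiased estimate of $\nabla f(x)$ with variance bounded by $\sigma^2$, and $\|\nabla\tilde f(x,z)\|_\infty\le G_\infty$ for all $x\in\mathcal{K}$, $z\in\mathbb{R}^q$. Run the Quantized Frank-Wolfe (QFW) algorithm described in the context for $T$ rounds from $x_1\in\mathcal{K}$ with: $p_i=2^{i-1}$; $S_{i,1}=\frac{\sigma^2p_i^2}{ML^2D^2}$; $S_{i,k}=p_i/M=2^{i-1}/M$ for $i\ge1,k\ge2$; $\eta_{i,k}=2/(p_i+k)=2/(2^{i-1}+k)$; and the $s$-Partition Encoding Scheme with levels $s_{1,i,1}=\sqrt{dp_i^2/M}$, $s_{2,i,1}=\sqrt{dp_i^2}$ for $k=1$, and $s_{1,i,k}=\sqrt{dp_i/M}$, $s_{2,i,k}=\sqrt{dp_i}$ for $k\ge2$. Then $x_{T+1}\in\mathcal{K}$ and $$\mathbb{E}[f(x_{T+1})]-f(x^* )\le\frac{4D\sqrt{13L^2D^2+2G_\infty^2}+2LD^2}{T},$$ where $x^*$ is a minimizer of $f$ on $\mathcal{K}$.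
   Context: $\|\cdot\|$ is the Euclidean norm; gradients are with respect to $x$. There are $M$ workers and a master. A function is $L$-smooth on $\mathcal{K}$ if its gradient is $L$-Lipschitz on $\mathcal{K}$. Bounded variance means $\mathbb{E}_{z\sim P}\|\nabla\tilde f(x,z)-\nabla f(x)\|^2\le\sigma^2$ for $x\in\mathcal{K}$. $s$-Partition Encoding Scheme: for $g\in\mathbb{R}^d$ and each coordinate $i$, find $l_i\in\{0,\dots,s-1\}$ with $|g_i|/\|g\|_\infty\in[l_i/s,(l_i+1)/s]$ and let $b_i=l_i/s$ with probability $1-\frac{|g_i|}{\|g\|_\infty}s+l_i$, and $b_i=(l_i+1)/s$ with probability $\frac{|g_i|}{\|g\|_\infty}s-l_i$. The transmitted data are $\mathrm{sign}(g_i)b_i$ and $\|g\|_\infty$; the decoded vector $\phi'(g)$ has coordinates $\mathrm{sign}(g_i)b_i\|g\|_\infty$. QFW: rounds $t=1,\dots,T$ are grouped in consecutive periods of lengths $p_1,p_2,\dots$; round $t$ corresponds to $(i,k)$ with $t=\sum_{j=1}^{i-1}p_j+k$, $1\le k\le p_i$, and $x_{i,k}=x_t$, $\eta_{i,k}=\eta_t$. In round $(i,k)$ each worker $m$ draws a collection $\mathcal{S}_{i,k}^m$ of $S_{i,k}$ independent stochastic functions $\tilde f(\cdot,z)$ with $z\sim P$. Writing $f_{\mathcal{S}}$ for the average of the functions in $\mathcal{S}$, the worker computes $g_{i,1}^m=\nabla f_{\mathcal{S}_{i,1}^m}(x_t)$ if $k=1$, and $g_{i,k}^m=\nabla f_{\mathcal{S}_{i,k}^m}(x_t)-\nabla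 f_{\mathcal{S}_{i,k}^m}(x_{t-1})$ if $k\ge2$, and sends it encoded with level $s_{1,i,k}$. The master decodes these to $\Phi_{1,i,k}'(g_{i,k}^m)$, forms $\tilde g_{i,k}=\frac1M\sum_{m=1}^M\Phi_{1,i,k}'(g_{i,k}^m)$, and broadcasts it encoded with level $s_{2,i,k}$; workers decode it to $\Phi_{2,i,k}'(\tilde g_{i,k})$ and set $\bar g_{i,1}=\Phi_{2,i,1}'(\tilde g_{i,1})$ if $k=1$, $\bar g_{i,k}=\Phi_{2,i,k}'(\tilde g_{i,k})+\bar g_{i,k-1}$ if $k\ge2$. Then $v_{i,k}\in\arg\min_{v\in\mathcal{K}}\langle v,\bar g_{i,k}\rangle$ and $x_{t+1}=x_t+\eta_{i,k}(v_{i,k}-x_t)$. The random choices (sampling, encodings) are made independently.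
   Formalization: The batch sizes S and quantization levels s must be integers, which the given formulas cannot all be (e.g. √(2d) and √(4d)); they are rounded up to the next integer, S_{i,1} is taken to be at least 1 (for σ=0 or D=0), and L>0 is assumed since S_{i,1} divides by L. *)

(* Defs.v *)
From HB Require Import structures.
From mathcomp Require Import all_boot all_order all_algebra.
From mathcomp Require Import all_classical all_reals all_analysis.
Set Implicit Arguments.
Unset Strict Implicit.
Unset Printing Implicit Defensive.
Import Order.TTheory GRing.Theory Num.Theory.
Import numFieldNormedType.Exports.
Local Open Scope classical_set_scope.
Local Open Scope ring_scope.

Section Euclidean.
Context {R : realType} {d : nat}.
Implicit Types (x y g : 'rV[R]_d) (K : set 'rV[R]_d) (f : 'rV[R]_d -> R).

Definition dot x y : R := \sum_(i < d) x 0 i * y 0 i.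

(* The library norm `|x| on 'rV[R]_d is the sup norm; enorm is the Euclidean
   one, and both induce the library's topology. *)
Definition enorm x : R := Num.sqrt (dot x x).

Definition grad f x : 'rV[R]_d := \row_(i < d) 'D_(delta_mx 0 i) f x.

Definition diameter K : R := sup [set enorm (x - y) | x in K & y in K].

(* The gradient at a point of K is that of f as a function on the whole space;
   nothing is required of f at points outside K. *)
Definition smooth_on K (L : R) f : Prop :=
  (forall x, K x -> differentiable f x) /\
  (forall x y, K x -> K y -> enorm (grad f x - grad f y) <= L * enorm (x - y)).

Definition is_argmin K f x : Prop := K x /\ forall y, K y -> f x <= f y.

End Euclidean.

Section PartitionEncoding.
Context {R : realType}.

(* The minn selects the index s - 1 when r = 1. *)
Definition partition_index (s : nat) (r : R) : nat :=
  minn (Num.truncn (r * s%:R)) s.-1.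

(* A draw u, uniform on [0, 1], rounds up when u < r s - l. *)
Definition partition_level (s : nat) (r u : R) : R :=
  let l := partition_index s r in (l + (u < r * s%:R - l%:R)%R)%:R / s%:R.

(* u i is the draw used for coordinate i; if g = 0 the ratio is 0 / 0 = 0 and
   the result is 0 because of the sign. *)
Definition partition_decode d (s : nat) (g : 'rV[R]_d) (u : 'I_d -> R) :
    'rV[R]_d :=
  \row_(i < d) (Num.sg (g 0 i) * partition_level s (`|g 0 i| / `|g|) (u i)
                * `|g|).

Lemma partition_indexP (s : nat) (r : R) : (0 < s)%N -> 0 <= r <= 1 ->
  let l := partition_index s r in
  (l < s)%N /\ l%:R / s%:R <= r <= l.+1%:R / s%:R.
Proof.
move=> s0 /andP[r0 r1] /=; have s0' : 0 < s%:R :> R by rewrite ltr0n.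
have rs0 : 0 <= r * s%:R by rewrite mulr_ge0.
have ls : (partition_index s r < s)%N.
  by rewrite /partition_index (leq_ltn_trans (geq_minr _ _))// prednK.
split=> //; rewrite ler_pdivrMr// ler_pdivlMr//.
have /andP[t1 t2] := truncn_itv rs0.
apply/andP; split; first by rewrite (le_trans _ t1)// ler_nat geq_minl.
rewrite /partition_index; case: leqP => h; first exact: ltW.
by rewrite prednK// ler_piMl.
Qed.

Lemma partition_level_law (s : nat) (r : R) : (0 < s)%N -> 0 <= r <= 1 ->
  let l := partition_index s r in
  let U := uniform_prob (@ltr01 R) in
  U [set u | partition_level s r u = l%:R / s%:R]
    = (1 - r * s%:R + l%:R)%:E /\
  U [set u | partition_level s r u = l.+1%:R / s%:R]
    = (r * s%:R - l%:R)%:E.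
Proof.
move=> s0 r01 /=; set l := partition_index s r.
have s0' : 0 < s%:R :> R by rewrite ltr0n.
have [ls] := partition_indexP s0 r01; rewrite -/l => /andP[].
rewrite ler_pdivrMr// ler_pdivlMr// => lr rl.
have c01 : 0 <= r * s%:R - l%:R <= 1.
  by rewrite subr_ge0 lr/= lerBlDl natr1.
set c := r * s%:R - l%:R in c01 *; have /andP[c0 c1] := c01.
have levelE (k : nat) u : (partition_level s r u = k%:R / s%:R) =
    ((l + (u < c)%R)%N = k).
  rewrite /partition_level -/l -/c; apply/propext; split=> [|->//].
  by move/(mulIf (invr_neq0 (lt0r_neq0 s0'))) => /eqP; rewrite eqr_nat => /eqP.
have Uc : uniform_prob (@ltr01 R) [set u | u < c] = c%:E.
  rewrite /uniform_prob integral_uniform_pdf.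
  have -> : [set u | u < c] `&` `[0, 1] = `[0, c[%classic :> set R.
    apply/seteqP; split=> x /=; rewrite !in_itv/=.
      by move=> [-> /andP[->]].
    by move=> /andP[-> xc]; split=> //; rewrite (le_trans (ltW xc)).
  rewrite (eq_integral (cst 1%E)); last first.
    move=> x; rewrite inE/= in_itv/= => /andP[x0 xc].
    by rewrite /uniform_pdf x0 (le_trans (ltW xc) c1)/= subr0 invr1.
  rewrite integral_cst//= mul1e lebesgue_measure_itv/= lte_fin.
  by case: ltgtP c0 => // [_|<-]; rewrite ?oppr0 ?adde0 ?sube0.
split; last first.
  rewrite -Uc; congr (uniform_prob _ _); apply/seteqP; split=> u /=;
    rewrite levelE; first by case: ltP => // _ /eqP; rewrite addn0 -addn1 -{1}(addn0 l) eqn_add2l.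
  by move=> ->; rewrite addn1.
have -> : [set u | partition_level s r u = l%:R / s%:R] = ~` [set u | u < c].
  apply/seteqP; split=> u /=; rewrite levelE.
    by case: ltP => // _ /eqP; rewrite -{2}(addn0 l) eqn_add2l.
  by case: ltP => // _ _; rewrite addn0.
have mc : measurable [set u : R | u < c].
  suff -> : [set u : R | u < c] = `]-oo, c[%classic by exact: measurable_itv.
  by apply/seteqP; split => x /=; rewrite in_itv.
transitivity (1 - uniform_prob (@ltr01 R) [set u | (u < c)%R])%E.
  exact: (probability_setC (uniform_prob (@ltr01 R)) mc).
rewrite Uc -EFinB.
by congr (_%:E); rewrite /c opprB addrA addrAC.
Qed.

End PartitionEncoding.

(* (i, k) for round t, both counted from 1; (1, 0) precedes the first round. *)
Fixpoint period_pos (p : nat -> nat) (t : nat) : nat * nat :=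
  if t is t'.+1 then
    let: (i, k) := period_pos p t' in
    if (k < p i)%N then (i, k.+1) else (i.+1, 1%N)
  else (1%N, 0%N).

Lemma period_posP (p : nat -> nat) (t : nat) :
  (forall i, (0 < p i)%N) -> (0 < t)%N ->
  let: (i, k) := period_pos p t in
  [/\ (0 < i)%N, (0 < k <= p i)%N & t = (\sum_(1 <= j < i) p j + k)%N].
Proof.
move=> p0; case: t => // t _; elim: t => [|t].
  by rewrite /= p0 big_geq// p0.
rewrite -[period_pos p t.+2]/(let: (i, k) := period_pos p t.+1 in
  if (k < p i)%N then (i, k.+1) else (i.+1, 1%N)).
case: (period_pos p t.+1) => i k [i0 /andP[k0 kp] ->].
case: ifPn => [kpi|]; first by split; rewrite ?addnS.
rewrite -leqNgt => pk; have -> : k = p i by apply/eqP; rewrite eqn_leq kp.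
by split=> //; rewrite ?p0// big_nat_recr//= addn1.
Qed.

(* One realization of quantized Frank-Wolfe. Here z t m j is the j-th sample of
   worker m in round t, u t m i and w t i are the draws used by worker m and by
   the master to encode coordinate i in round t, and v t is the Frank-Wolfe
   vertex of round t, which the theorem constrains to be a minimizer. Rounds
   are counted from 1. *)
Section QFW.
Context {R : realType} {d : nat} {Z : Type} {M : nat}.
Variables (ft : 'rV[R]_d -> Z -> R).
Variables (p : nat -> nat) (S s1 s2 : nat -> nat -> nat).
Variables (eta : nat -> nat -> R) (x1 : 'rV[R]_d).
Variables (z : nat -> 'I_M -> nat -> Z).
Variables (u : nat -> 'I_M -> 'I_d -> R) (w : nat -> 'I_d -> R).
Variables (v : nat -> 'rV[R]_d).

Definition at_round (T : Type) (c : nat -> nat -> T) (t : nat) : T :=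
  let: (i, k) := period_pos p t in c i k.

Definition period_start (t : nat) : bool := (period_pos p t).2 == 1%N.

Fixpoint qfw_x (t : nat) : 'rV[R]_d :=
  match t with
  | t'.+1 => if t' is 0 then x1
             else qfw_x t' + at_round eta t' *: (v t' - qfw_x t')
  | 0 => x1
  end.

Definition batch_mean (t : nat) (m : 'I_M) (x : 'rV[R]_d) : R :=
  (\sum_(j < at_round S t) ft x (z t m j)) / (at_round S t)%:R.

Definition worker_grad (t : nat) (m : 'I_M) : 'rV[R]_d :=
  if period_start t then grad (batch_mean t m) (qfw_x t)
  else grad (batch_mean t m) (qfw_x t) - grad (batch_mean t m) (qfw_x t.-1).

Definition master_avg (t : nat) : 'rV[R]_d :=
  M%:R^-1 *:
    \sum_(m < M) partition_decode (at_round s1 t) (worker_grad t m) (u t m).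

Definition master_decode (t : nat) : 'rV[R]_d :=
  partition_decode (at_round s2 t) (master_avg t) (w t).

Fixpoint grad_est (t : nat) : 'rV[R]_d :=
  if t is t'.+1 then
    if period_start t then master_decode t else master_decode t + grad_est t'
  else 0.

End QFW.

Section Independence.
Context {dO : measure_display} {Omega : measurableType dO} {R : realType}.

Definition mutually_independent (Pr : probability Omega R) (I : Type)
    (F : I -> set (set Omega)) : Prop :=
  forall (n : nat) (s : 'I_n -> I) (A : 'I_n -> set Omega),
    injective s -> (forall k, F (s k) (A k)) ->
    Pr (\bigcap_(k in [set: 'I_n]) A k) = (\prod_(k < n) Pr (A k))%E.

Definition sigma_of d' (T : measurableType d') (X : Omega -> T) :
  set (set Omega) := preimage_set_system setT X measurable.

Variant source (M d : nat) : Type :=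
  | Sample of nat & 'I_M & nat
  | WorkerDraw of nat & 'I_M & 'I_d
  | MasterDraw of nat & 'I_d.

Definition source_round M d (a : source M d) : nat :=
  match a with
  | Sample t _ _ | WorkerDraw t _ _ | MasterDraw t _ => t
  end.

Definition source_sigma d' (Z : measurableType d') M d
    (z : nat -> 'I_M -> nat -> Omega -> Z)
    (u : nat -> 'I_M -> 'I_d -> Omega -> R) (w : nat -> 'I_d -> Omega -> R)
    (a : source M d) : set (set Omega) :=
  match a with
  | Sample t m j => sigma_of (z t m j)
  | WorkerDraw t m i => sigma_of (u t m i)
  | MasterDraw t i => sigma_of (w t i)
  end.

Definition history M d (F : source M d -> set (set Omega)) (t : nat) :
    set (set Omega) :=
  <<s \bigcup_(a in [set a | (source_round a <= t)%N]) F a >>.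

Definition history_measurable d (H : set (set Omega))
    (X : Omega -> 'rV[R]_d) : Prop :=
  forall (i : 'I_d) (B : set R), measurable B ->
    H ((fun om => X om 0 i) @^-1` B).

End Independence.

Definition nceil {R : realType} (a : R) : nat := `|Num.ceil a|%N.

(* Main.v *)
From HB Require Import structures.
Require Import Defs.
From mathcomp Require Import all_boot all_order all_algebra.
From mathcomp Require Import all_classical all_reals all_analysis.
From mathcomp Require Import measurable_realfun zify ring lra.
Import Order.TTheory GRing.Theory Num.Theory.
Import numFieldNormedType.Exports.
Local Open Scope classical_set_scope.
Local Open Scope ring_scope.
Set Implicit Arguments.
Unset Strict Implicit.
Unset Printing Implicit Defensive.

(** Why the rate holds. The step sizes are [2 / (t + 1)], those of the classical
    Frank-Wolfe method. For a convex smooth function, one step taken with an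
    estimate of the gradient whose error is [e] decreases the gap to the optimum as

      gap_(t+1) <= (1 - 2/(t+1)) gap_t + 2/(t+1) D |e| + 2 L D^2 / (t+1)^2

    ([frank_wolfe_step]). If the root mean square of [e] at round [t] is at most
    [C / (t + 1)], then multiplying by [t (t + 1)] makes the recursion telescope
    ([weighted_recursion]) and the expected gap after [T] rounds is at most
    [(2 D C + 2 L D^2) / T]. It remains to prove this bound on the error with
    [C = 2 sqrt (13 L^2 D^2 + 2 Ginf^2)] ([mse_le]).

    The error of the estimate is the error inherited from the previous round of
    the same period, plus three noises: the sampling of the workers, their
    encodings, and the encoding of the master ([error_decomposition]). Each noise
    is driven by sources of randomness that have not been used before and has
    mean zero whatever the past is; for the encodings this is
    [decode_coord_unbiased]. So all these terms are orthogonal and their second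
    moments add up ([coordinate_pythagoras], [round_error]). In the first round of
    a period of length [p] they sum to at most [(L^2 D^2 + 2 Ginf^2) / p^2]
    ([mse_start]). In each later round the workers send differences of gradients
    at consecutive iterates, which are [O (1 / p)], and the round adds at most
    [12 L^2 D^2 / p^3] ([mse_step]). A period has [p] rounds, and [t + 1 <= 2 p]
    for its rounds [t].

    Conditional expectations are avoided as follows. The sigma-algebra of the
    sources used so far is independent of any other source ([known_independent]).
    Hence a function of the past and of a fresh source can be integrated by
    freezing the past and averaging over the fresh source alone ([freeze_le], and
    [fresh_orthogonal] for zero means). This needs the stochastic gradient at a
    random iterate to be jointly measurable in the past and the sample, which
    follows from its Lipschitz continuity in the iterate
    ([lipschitz_joint_measurable]). *)


(** * Bounded random variables *)

(** On a probability space a bounded measurable function is integrable, so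
    inside this class expectations are linear and monotone without side
    conditions. Every random quantity of the algorithm is in it, because the
    iterates stay in a compact set and the stochastic gradients are bounded. *)

Definition bmeas {R : realType} d (T : measurableType d) (f : T -> R) :=
  measurable_fun setT f /\ exists C, forall x, `|f x| <= C.

Section Closure.
Context {R : realType} d (T : measurableType d).
Implicit Types f g : T -> R.

Lemma bmeas_cst (c : R) : bmeas (fun _ : T => c).
Proof. by split; [exact: measurable_cst|exists `|c|]. Qed.

Lemma bmeasD f g : bmeas f -> bmeas g -> bmeas (fun x => f x + g x).
Proof.
move=> [mf [C fC]] [mg [D gD]]; split; first exact: measurable_funD.
by exists (C + D) => x; rewrite (le_trans (ler_normD _ _))// lerD.
Qed.

Lemma bmeasM f g : bmeas f -> bmeas g -> bmeas (fun x => f x * g x).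
Proof.
move=> [mf [C fC]] [mg [D gD]]; split; first exact: measurable_funM.
by exists (C * D) => x; rewrite normrM ler_pM.
Qed.

Lemma bmeasZ (c : R) f : bmeas f -> bmeas (fun x => c * f x).
Proof. by apply: bmeasM; exact: bmeas_cst. Qed.

Lemma bmeasN f : bmeas f -> bmeas (fun x => - f x).
Proof. by move=> bf; under eq_fun do rewrite -mulN1r; exact: bmeasZ. Qed.

Lemma bmeasB f g : bmeas f -> bmeas g -> bmeas (fun x => f x - g x).
Proof. by move=> bf bg; apply: bmeasD => //; exact: bmeasN. Qed.

Lemma bmeasX f n : bmeas f -> bmeas (fun x => f x ^+ n).
Proof.
move=> bf; elim: n => [|n IH]; first exact: bmeas_cst.
by under eq_fun do rewrite exprS; exact: bmeasM.
Qed.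

Lemma bmeas_sum (I : Type) (s : seq I) (P : pred I) (f : I -> T -> R) :
  (forall i, bmeas (f i)) -> bmeas (fun x => \sum_(i <- s | P i) f i x).
Proof.
move=> bf; elim: s => [|i s IH].
  by under eq_fun do rewrite big_nil; exact: bmeas_cst.
under eq_fun do rewrite big_cons.
by case: (P i) => //; exact: bmeasD.
Qed.

Lemma bmeas_integrable (Pr : probability T R) f :
  bmeas f -> Pr.-integrable setT (EFin \o f).
Proof.
move=> [mf [C fC]]; apply: measurable_bounded_integrable => //=.
  by rewrite (le_lt_trans (probability_le1 _ _))// ltry.
exists C; split; first exact: num_real.
by move=> M CM x _ /=; rewrite (le_trans (fC x))// ltW.
Qed.

End Closure.

Lemma bmeas_comp {R : realType} d d' (T : measurableType d) (T' : measurableType d')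
    (h : T -> T') (f : T' -> R) :
  measurable_fun setT h -> bmeas f -> bmeas (f \o h).
Proof.
move=> mh [mf [C fC]]; split; first exact: measurableT_comp.
by exists C => x; exact: fC.
Qed.

Ltac bmeas_auto := repeat first
  [ assumption
  | lazymatch goal with
    | |- bmeas (fun x => (@?f x + @?g x)%R) => apply: bmeasD
    | |- bmeas (fun x => (@?f x * @?g x)%R) => apply: bmeasM
    | |- bmeas (fun x => (@?f x ^+ _)%R) => apply: bmeasX
    end
  | exact: bmeas_cst ].

Section Expectation.
Context {R : realType} d (T : measurableType d) (Pr : probability T R).
Implicit Types f g : T -> R.

Lemma mean_add f g : bmeas f -> bmeas g ->
  \int[Pr]_x (f x + g x) = \int[Pr]_x f x + \int[Pr]_x g x.
Proof. by move=> bf bg; rewrite RintegralD//; exact: bmeas_integrable. Qed.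

Lemma mean_sub f g : bmeas f -> bmeas g ->
  \int[Pr]_x (f x - g x) = \int[Pr]_x f x - \int[Pr]_x g x.
Proof. by move=> bf bg; rewrite RintegralB//; exact: bmeas_integrable. Qed.

Lemma mean_scale (c : R) f : bmeas f ->
  \int[Pr]_x (c * f x) = c * \int[Pr]_x f x.
Proof. by move=> bf; rewrite RintegralZl//; exact: bmeas_integrable. Qed.

Lemma mean_cst (c : R) : \int[Pr]_x c = c.
Proof.
have -> := Rintegral_cst Pr measurableT c.
by rewrite [X in fine X]probability_setT mulr1.
Qed.

Lemma mean_mono f g : bmeas f -> bmeas g -> (forall x, f x <= g x) ->
  \int[Pr]_x f x <= \int[Pr]_x g x.
Proof.
by move=> bf bg fg; apply: le_Rintegral => //; exact: bmeas_integrable.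
Qed.

Lemma mean_sum (I : Type) (s : seq I) (P : pred I) (f : I -> T -> R) :
  (forall i, bmeas (f i)) ->
  \int[Pr]_x (\sum_(i <- s | P i) f i x) = \sum_(i <- s | P i) \int[Pr]_x f i x.
Proof.
move=> bf; elim: s => [|i s IH].
  by under eq_Rintegral do rewrite big_nil; rewrite mean_cst big_nil.
under eq_Rintegral do rewrite big_cons.
rewrite big_cons; case: (P i) => //; rewrite mean_add ?IH//.
exact: bmeas_sum.
Qed.

End Expectation.

(** * Independence of a fresh source from what is already known *)

Section Independence.
Context {dO : measure_display} {Omega : measurableType dO} {R : realType}.
Variables (Pr : probability Omega R) (I : Type) (F : I -> set (set Omega)).
Hypothesis FT : forall a, F a setT.
Hypothesis FI : forall a, setI_closed (F a).
Hypothesis Fm : forall a, F a `<=` measurable.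
Hypothesis Find : mutually_independent Pr F.

Definition sources_sigma (A : set I) : set (set Omega) :=
  \bigcup_(a in A) F a.

(** The sample space seen through the sources in [A] alone: a random variable
    on [Omega] is determined by these sources when it is measurable as a
    function on [known A]. *)
Definition known (A : set I) : Type :=
  g_sigma_algebraType (sources_sigma A).
HB.instance Definition _ A := Measurable.on (known A).

(* Finite families of sources are handled as duplicate-free sequences, which
   need a decidable equality on the index type. *)
Let Ic := {classic I}.

Lemma independent_prod (s : seq Ic) (E : Ic -> set Omega) :
  uniq s -> (forall a, F a (E a)) ->
  Pr (\bigcap_(a in [set` s]) E a) = (\prod_(a <- s) Pr (E a))%E.
Proof.
move=> us FE; rewrite big_tnth -(@Find _ (tnth (in_tuple s)) (E \o tnth (in_tuple s))).
- congr (Pr _); apply/seteqP; split => x /= h.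
    by move=> k _; apply: h => /=; exact: mem_tnth.
  by move=> a /= /seq_tnthP[k ->]; exact: h.
- exact: (elimT (tuple_uniqP (in_tuple s)) us).
- by move=> k /=; exact: FE.
Qed.

(** The pi-system that generates [sources_sigma A]. An event is picked for every
    source, also outside of [s], so that two such meets combine without any
    matching of their index sequences. *)
Definition finite_meets (A : set I) : set (set Omega) :=
  [set X | exists s : seq Ic, exists E : Ic -> set Omega,
    [/\ forall a, a \in s -> A a, forall a, F a (E a) &
        X = \bigcap_(a in [set` s]) E a]].

Lemma finite_meetsI A : setI_closed (finite_meets A).
Proof.
move=> _ _ [s [E [sA FE ->]]] [s' [E' [sA' FE' ->]]].
exists (s ++ s').
exists (fun a => (if a \in s then E a else setT) `&`
                 (if a \in s' then E' a else setT)); split.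
- by move=> a; rewrite mem_cat => /orP[/sA|/sA'].
- by move=> a; apply: FI; case: ifP.
- apply/seteqP; split => [x [h h'] a _ | x h].
    by split; case: ifPn => // ?; [exact: h|exact: h'].
  split => a /= as_; have := h a; rewrite /= mem_cat as_ ?orbT => /(_ isT)[];
  by case: ifP.
Qed.

Lemma known_measurable A : <<s sources_sigma A >> `<=` measurable.
Proof.
apply: smallest_sub; first exact: sigma_algebra_measurable.
by move=> X [a _ /Fm].
Qed.

(** Mutual independence speaks of finitely many events of distinct sources only;
    Dynkin's pi-lambda theorem carries the product rule from the finite meets to
    the sigma-algebra that they generate. *)
Lemma known_independent (A : set I) (b : I) (X B : set Omega) :
  ~ A b -> <<s sources_sigma A >> X -> F b B ->
  Pr (X `&` B) = (Pr X * Pr B)%E.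
Proof.
move=> Ab AX FB.
have {}AX : <<s finite_meets A >> X.
  move: X AX; apply: sub_smallest2r; first exact: smallest_sigma_algebra.
  move=> Y [a Aa FaY].
  exists [:: (a : Ic)]; exists (fun c : Ic => if c == a then Y else setT).
  split=> [c||]; first by rewrite inE => /eqP ->.
    by move=> c; case: eqVneq => [->|].
  apply/seteqP; split => x; first by move=> Yx c /=; rewrite inE => ->.
  by move=> /(_ a); rewrite /= inE eqxx => /(_ isT).
have mB := Fm FB.
pose H := [set X | measurable X /\ Pr (X `&` B) = (Pr X * Pr B)%E].
suff: <<s finite_meets A >> `<=` H by move=> /(_ _ AX)[].
apply: lambda_system_subset; [exact: finite_meetsI| | |by []].
- apply/dynkin_lambda_system; split.
  + by split=> //; rewrite setTI probability_setT mul1e.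
  + move=> S [mS hS]; split; first exact: measurableC.
    have -> : ~` S `&` B = B `\` S by rewrite setDE setIC.
    have -> : Pr (B `\` S) = (Pr B - Pr (S `&` B))%E.
      by rewrite setIC measureD// (le_lt_trans (probability_le1 _ _))// ltry.
    rewrite hS probability_setC// muleBl ?mul1e//.
    exact: fin_num_measure.
  + move=> S tS hS; split.
      by apply: bigcup_measurable => n _; have [] := hS n.
    rewrite setI_bigcupl (measure_bigcup Pr)//=; last 2 first.
      by move=> n _; apply: measurableI => //; have [] := hS n.
      exact: trivIset_setIr.
    rewrite (measure_bigcup Pr)//=; last by move=> n _; have [] := hS n.
    rewrite muleC -(fineK (fin_num_measure Pr B mB)) -nneseriesZl//.
    by apply: eq_eseriesr => n _; rewrite fineK ?fin_num_measure// (hS n).2 muleC.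
- move=> _ [s [E [sA FE ->]]]; split.
    by apply: fin_bigcap_measurable => // a _; exact: Fm (FE a).
  pose E' (a : Ic) := if a == b then B else E a.
  have FE' a : F a (E' a) by rewrite /E'; case: eqVneq => [->|].
  have bs : (b : Ic) \notin undup s.
    by rewrite mem_undup; apply/negP => /sA.
  have sE : [set` s] = [set` undup s].
    by apply/seteqP; split=> a /=; rewrite mem_undup.
  have -> : \bigcap_(a in [set` s]) E a `&` B =
      \bigcap_(a in [set` (b : Ic) :: undup s]) E' a.
    rewrite sE; apply/seteqP; split => x.
      move=> [h Bx] a /=; rewrite inE /E'; case: eqVneq => //= _; exact: h.
    move=> h; split; last by have := h b; rewrite /= inE eqxx /E' eqxx; exact.
    move=> a /= au; have := h a; rewrite /= inE au orbT /E' => /(_ isT).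
    by case: eqVneq => // ab; move: bs; rewrite -ab au.
  rewrite independent_prod//= ?bs ?undup_uniq// big_cons sE.
  rewrite independent_prod ?undup_uniq// {1}/E' eqxx muleC.
  congr (_ * _)%E; rewrite big_seq_cond [RHS]big_seq_cond.
  apply: eq_bigr => a; rewrite andbT /E' => au.
  by case: eqVneq => // ab; move: bs; rewrite -ab au.
Qed.

End Independence.

Section Freezing.
Context {dO : measure_display} {Omega : measurableType dO} {R : realType}.
Variables (Pr : probability Omega R) (I : Type) (F : I -> set (set Omega)).
Hypothesis FT : forall a, F a setT.
Hypothesis FI : forall a, setI_closed (F a).
Hypothesis Fm : forall a, F a `<=` measurable.
Hypothesis Find : mutually_independent Pr F.

Lemma known_id_measurable (A : set I) :
  measurable_fun setT (fun om : Omega => om : known F A).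
Proof. by move=> _ B mB; rewrite setTI; exact: (known_measurable Fm mB). Qed.

Section Fresh.
Variables (A : set I) (b : I) (Ab : ~ A b).
Context {d' : measure_display} {T : measurableType d'}.
Variables (xi : {RV Pr >-> T}) (nu : probability T R).
Hypothesis Fxi : F b = sigma_of xi.
Hypothesis nuE : forall B, measurable B -> distribution Pr xi B = nu B.

Lemma freeze_measurable :
  measurable_fun setT (fun om : Omega => (om : known F A, xi om)).
Proof.
apply/measurable_fun_pair; first exact: known_id_measurable.
exact: measurable_funPT.
Qed.

(** Known information can be frozen when a fresh source is averaged out: the pair
    of the known information and of the fresh value is distributed as a product
    measure, since the two laws agree on rectangles by independence, and Fubini's
    theorem computes the inner integral with [om] fixed. This replaces
    conditional expectations throughout. *)
Lemma freeze_le (phi : known F A * T -> R) (c : R) : bmeas phi ->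
  (forall om, \int[nu]_zeta phi (om, zeta) <= c) ->
  \int[Pr]_om phi (om, xi om) <= c.
Proof.
move=> bphi phic.
pose idm : {mfun Omega >-> known F A} :=
  HB.pack_for {mfun Omega >-> known F A} (fun om : Omega => om : known F A)
    (isMeasurableFun.Build _ _ _ _ _ (@known_id_measurable A)).
pose pairm : {mfun Omega >-> (known F A * T)%type} :=
  HB.pack_for {mfun Omega >-> (known F A * T)%type}
    (fun om : Omega => (om : known F A, xi om))
    (isMeasurableFun.Build _ _ _ _ _ freeze_measurable).
pose m1 := distribution Pr idm.
have J (X : set (known F A * T)) : measurable X ->
    (m1 \x nu)%E X = distribution Pr pairm X.
  apply: product_measure_unique => X1 X2 mX1 mX2.
  have Fb : F b (xi @^-1` X2) by rewrite Fxi; exists X2 => //; rewrite setTI.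
  have := known_independent FT FI Fm Find Ab mX1 Fb.
  by rewrite -[Pr (xi @^-1` _)]/(distribution Pr xi X2) nuE.
have iphi : (m1 \x nu)%E.-integrable setT (EFin \o phi).
  have /integrableP[mphi fin] := bmeas_integrable (distribution Pr pairm) bphi.
  apply/integrableP; split => //.
  by rewrite (eq_measure_integral (distribution Pr pairm)) => // X mX _; exact: J.
have -> : \int[Pr]_om phi (om, xi om) =
    fine (\int[m1]_om \int[nu]_zeta (phi (om, zeta))%:E)%E.
  rewrite /Rintegral; congr fine.
  rewrite (@integral12_prod_meas1 _ _ _ _ _ m1 nu (EFin \o phi))//.
  rewrite (eq_measure_integral (distribution Pr pairm)); last first.
    by move=> X mX _; exact: J.
  rewrite integral_distribution//; first by case: bphi => /measurable_EFinP.
  exact: bmeas_integrable (bmeas_comp freeze_measurable bphi).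
have iF := @integrable_fubini_F _ _ _ _ _ m1 nu (EFin \o phi) iphi.
rewrite -lee_fin fineK; last exact: integrable_fin_num.
apply: (@le_trans _ _ (\int[m1]_om c%:E)%E).
  apply: le_integral => //.
    exact: (bmeas_integrable (distribution Pr idm) (@bmeas_cst R _ (known F A) c)).
  move=> om _; rewrite -[leLHS]fineK ?lee_fin; first exact: phic.
  apply: integrable_fin_num => //.
  apply: (@bmeas_integrable _ _ _ nu (fun zeta => phi (om, zeta))).
  apply: (bmeas_comp _ bphi); exact: pair1_measurable.
by rewrite integral_cst//= [X in (_ * X)%E]probability_setT mule1.
Qed.

Lemma freeze_eq0 (phi : known F A * T -> R) : bmeas phi ->
  (forall om, \int[nu]_zeta phi (om, zeta) = 0) ->
  \int[Pr]_om phi (om, xi om) = 0.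
Proof.
move=> bphi phi0; apply/eqP; rewrite eq_le; apply/andP; split.
  by apply: freeze_le => // om; rewrite phi0.
have bom : bmeas (fun om => phi (om, xi om)).
  exact: bmeas_comp freeze_measurable bphi.
rewrite -oppr_le0 -mulN1r -mean_scale//.
apply: (@freeze_le (fun z => -1 * phi z)); first exact: bmeasZ.
move=> om /=; rewrite mean_scale ?phi0 ?mulr0//.
apply: (bmeas_comp _ bphi); exact: pair1_measurable.
Qed.

(** A noise that averages to zero for every value of the known information is
    orthogonal to everything known: freezing the known factor leaves a multiple
    of a zero mean. *)
Lemma fresh_orthogonal (W : Omega -> R) (phi : known F A * T -> R) :
  bmeas (W : known F A -> R) -> bmeas phi ->
  (forall om, \int[nu]_zeta phi (om, zeta) = 0) ->
  \int[Pr]_om (W om * phi (om, xi om)) = 0.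
Proof.
move=> bW bphi phi0.
apply: (@freeze_eq0 (fun z => W z.1 * phi z)).
  by apply: bmeasM => //; apply: bmeas_comp bW; exact: measurable_fst.
move=> om /=; rewrite mean_scale ?phi0 ?mulr0//.
apply: (bmeas_comp _ bphi); exact: pair1_measurable.
Qed.

Lemma known_bmeas (W : Omega -> R) : bmeas (W : known F A -> R) -> bmeas W.
Proof. exact: bmeas_comp (@known_id_measurable A). Qed.

Lemma fresh_pythagoras (W : Omega -> R) (phi : known F A * T -> R) :
  bmeas (W : known F A -> R) -> bmeas phi ->
  (forall om, \int[nu]_zeta phi (om, zeta) = 0) ->
  \int[Pr]_om (W om + phi (om, xi om)) ^+ 2 =
  \int[Pr]_om (W om) ^+ 2 + \int[Pr]_om (phi (om, xi om)) ^+ 2.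
Proof.
move=> bW bphi phi0.
have bW' := known_bmeas bW.
have bp : bmeas (fun om => phi (om, xi om)).
  exact: bmeas_comp freeze_measurable bphi.
under eq_Rintegral do rewrite sqrrD addrAC -mulr_natl.
rewrite !mean_add ?mean_scale ?(fresh_orthogonal bW bphi phi0) ?mulr0 ?addr0//.
all: by bmeas_auto.
Qed.

End Fresh.

Lemma known_sub_measurable (A A' : set I) : A `<=` A' ->
  measurable_fun setT (fun om : known F A' => om : known F A).
Proof.
move=> AA' _ B mB; rewrite setTI.
move: mB; apply: sub_smallest2r; first exact: smallest_sigma_algebra.
exact: bigcup_subset.
Qed.

Lemma known_mono (A A' : set I) (W : Omega -> R) : A `<=` A' ->
  bmeas (W : known F A -> R) -> bmeas (W : known F A' -> R).
Proof. by move=> AA'; exact: (bmeas_comp (known_sub_measurable AA')). Qed.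

(** A source is known to any set of sources that contains it, whence by
    [fresh_known] a noise becomes part of the known information once its source
    is added. *)
Lemma known_source (A : set I) (b : I) d' (T : measurableType d')
    (xi : Omega -> T) : A b -> F b = sigma_of xi ->
  measurable_fun setT (xi : known F A -> T).
Proof.
move=> Ab Fxi _ B mB; apply: sub_sigma_algebra.
by exists b => //; rewrite Fxi; exists B.
Qed.

Section FreshSum.
Context {d' : measure_display} {T : measurableType d'}.

Lemma fresh_prod_mono (A A' : set I) (phi : known F A * T -> R) :
  A `<=` A' -> bmeas phi -> bmeas (phi : known F A' * T -> R).
Proof.
move=> AA' bphi; refine (@bmeas_comp _ _ _ _ _
  (fun z : known F A' * T => z : known F A * T) phi _ bphi : bmeas _).
apply/measurable_fun_pairP; split; last exact: measurable_snd.
apply: (measurableT_comp (known_sub_measurable AA')); exact: measurable_fst.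
Qed.

Lemma fresh_known (A A' : set I) (b : I) (xi : Omega -> T)
    (phi : known F A * T -> R) :
  A `<=` A' -> A' b -> F b = sigma_of xi -> bmeas phi ->
  bmeas ((fun om => phi (om, xi om)) : known F A' -> R).
Proof.
move=> AA' A'b Fxi bphi; refine (@bmeas_comp _ _ _ _ _
  (fun om : known F A' => (om : known F A, xi om)) phi _ bphi : bmeas _).
apply/measurable_fun_pair; first exact: known_sub_measurable.
exact: known_source A'b Fxi.
Qed.

(** The cross terms vanish one source at a time: each noise is orthogonal to the
    sum of [W] and of the earlier noises, all of which are known once their
    sources have been added to [A]. *)
Lemma fresh_sum_pythagoras (J : eqType) (s : seq J) (A : set I) (b : J -> I)
    (xi : J -> {RV Pr >-> T}) (nu : probability T R)
    (W : Omega -> R) (phi : J -> known F A * T -> R) :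
  uniq s -> injective b -> (forall j, ~ A (b j)) ->
  (forall j, F (b j) = sigma_of (xi j)) ->
  (forall j B, measurable B -> distribution Pr (xi j) B = nu B) ->
  bmeas (W : known F A -> R) -> (forall j, bmeas (phi j)) ->
  (forall j om, \int[nu]_zeta phi j (om, zeta) = 0) ->
  \int[Pr]_om (W om + \sum_(j <- s) phi j (om, xi j om)) ^+ 2 =
  \int[Pr]_om (W om) ^+ 2 +
    \sum_(j <- s) \int[Pr]_om (phi j (om, xi j om)) ^+ 2.
Proof.
move=> us injb Ab Fxi nuE; move: W phi.
have {Ab} : forall j, j \in s -> ~ A (b j) by move=> j _; exact: Ab.
elim: s A us => [|j s IH] A /=.
  move=> _ _ W phi _ _ _; rewrite big_nil addr0.
  by apply: eq_Rintegral => om _; rewrite big_nil addr0.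
move=> /andP[js us] Ab W phi bW bphi phi0.
pose A' := A `|` [set b j].
have AA' : A `<=` A' by left.
under eq_Rintegral do rewrite big_cons addrA.
rewrite (IH A' us _ (fun om => W om + phi j (om, xi j om)) phi); first last.
- exact: phi0.
- by move=> k; exact: fresh_prod_mono AA' (bphi k).
- apply: bmeasD; first exact: known_mono AA' bW.
  by apply: (fresh_known AA') => //; right.
- move=> k ks [|/injb kj]; first by apply: Ab; rewrite inE ks orbT.
  by move: js; rewrite -kj ks.
rewrite big_cons addrA; congr (_ + _).
have Abj : ~ A (b j) by apply: Ab; rewrite inE eqxx.
exact: (fresh_pythagoras Abj (Fxi j) (nuE j) bW (bphi j) (phi0 j)).
Qed.

End FreshSum.

End Freezing.

(** * Joint measurability of Lipschitz random functions *)

Section SupNorm.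
Context {R : realType} {d : nat}.
Implicit Types x : 'rV[R]_d.

Lemma coord_le_norm x i : `|x 0 i| <= `|x|.
Proof.
by rewrite [leRHS]/Num.Def.normr /= mx_normrE; apply/bigmax_geP; right => /=; exists (0, i).
Qed.

Lemma norm_le_coord x (c : R) : 0 <= c -> (forall i, `|x 0 i| <= c) -> `|x| <= c.
Proof.
move=> c0 xc; rewrite [leLHS]/Num.Def.normr /= mx_normrE bigmax_le// => -[i j] _ /=.
by rewrite (ord1 i).
Qed.

End SupNorm.

Section Measurability.
Context {R : realType}.

Lemma measurable_pieces d1 d2 (T1 : measurableType d1) (T2 : measurableType d2)
    (C : countType) (kappa : T1 -> C) (h : C -> T1 -> T2) :
  (forall c, measurable (kappa @^-1` [set c])) ->
  (forall c, measurable_fun setT (h c)) ->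
  measurable_fun setT (fun x => h (kappa x) x).
Proof.
move=> mk mh.
pose E (n : nat) := [set x | pickle (kappa x) = n].
have ET : \bigcup_n E n = setT.
  by apply/seteqP; split => // x _; exists (pickle (kappa x)).
have mE n : measurable (E n).
  case pE : (@unpickle C n) => [c|].
    have [cn|cn] := eqVneq (pickle c) n.
      rewrite (_ : E n = kappa @^-1` [set c])//; apply/seteqP; split => x /=.
        by move=> xn; move: pE; rewrite -xn pickleK => -[].
      by rewrite /E /= => ->.
    rewrite (_ : E n = set0)//; apply/seteqP; split => x //= xn.
    by move: pE cn; rewrite -xn pickleK => -[->]; rewrite eqxx.
  rewrite (_ : E n = set0)//; apply/seteqP; split => x //= xn.
  by move: pE; rewrite -xn pickleK.
rewrite -ET; apply/measurable_fun_bigcup => // n.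
have [->|/set0P[x0 x0n]] := eqVneq (E n) set0; first exact: measurable_fun_set0.
apply: (eq_measurable_fun (h (kappa x0))); last exact: measurable_funTS.
move=> x; rewrite inE => xn; congr (h _ x).
by apply: (pcan_inj (@pickleK C)); rewrite xn x0n.
Qed.

Lemma measurable_uniform_limit d (T : measurableType d) (C : R)
    (h : nat -> T -> R) (f : T -> R) :
  (forall k, measurable_fun setT (h k)) ->
  (forall k x, `|f x - h k x| <= C * k.+1%:R^-1) -> measurable_fun setT f.
Proof.
move=> mh hf; apply: (measurable_fun_cvg mh) => x _.
apply/cvgrPdist_le => e e0.
have : (fun k : nat => C * k.+1%:R^-1 : R) @ \oo --> C * 0.
  by apply: cvgM; [exact: cvg_cst|exact: cvg_harmonic].
rewrite mulr0 => /cvgrPdist_le /(_ e e0); apply: filterS => k.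
rewrite sub0r normrN => ke; apply: le_trans (hf k x) _.
exact: le_trans (ler_norm _) ke.
Qed.

Lemma measurable_floor d (T : measurableType d) (f : T -> R) (n : int) :
  measurable_fun setT f -> measurable [set x | Num.floor (f x) = n].
Proof.
move=> mf; have -> : [set x | Num.floor (f x) = n] =
    f @^-1` `[n%:~R, (n + 1)%:~R[%classic.
  apply/seteqP; split => x /=; rewrite in_itv/= -floor_eq; first by move=> ->.
  by move/eqP.
by rewrite -[X in measurable X]setTI; apply: mf => //; exact: measurable_itv.
Qed.

(** The Caratheodory argument. Cut the space into the cells of a grid of mesh
    1/(k+1) and replace [X u] by one chosen point of [K] in its cell. Only
    countably many points are then used, so the measurability of each [g y]
    suffices for these approximations, and the Lipschitz bound makes them
    converge uniformly. *)
Lemma lipschitz_joint_measurable dU dT (U : measurableType dU)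
    (T : measurableType dT) (n : nat) (K : set 'rV[R]_n) (C : R)
    (X : U -> 'rV[R]_n) (g : 'rV[R]_n -> T -> R) :
  (forall u, K (X u)) -> (forall i, measurable_fun setT (fun u => X u 0 i)) ->
  (forall y y' zeta, K y -> K y' -> `|g y zeta - g y' zeta| <= C * `|y - y'|) ->
  (forall y, K y -> measurable_fun setT (g y)) ->
  measurable_fun setT (fun p : U * T => g (X p.1) p.2).
Proof.
move=> KX mX gC mg.
pose key (k : nat) (y : 'rV[R]_n) : {ffun 'I_n -> int} :=
  [ffun i => Num.floor (y 0 i * k.+1%:R)].
pose rep k (c : {ffun 'I_n -> int}) := xget 0 [set y | K y /\ key k y = c].
have repP k u : K (rep k (key k (X u))) /\ key k (rep k (key k (X u))) = key k (X u).
  rewrite /rep; case: xgetP => [y _ []//|/(_ (X u))] /=.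
  by case; split.
have close k u : `|X u - rep k (key k (X u))| <= k.+1%:R^-1.
  apply: norm_le_coord => // i; rewrite !mxE.
  have [_ /ffunP/(_ i)] := repP k u; rewrite !ffunE => e.
  have k0 : 0 < k.+1%:R :> R by rewrite ltr0n.
  have /andP[a1 a2] := floor_itv (X u 0 i * k.+1%:R).
  have /andP[b1 b2] := floor_itv ((rep k (key k (X u))) 0 i * k.+1%:R).
  rewrite -(ler_pM2r k0) mulVf ?gt_eqF//.
  rewrite -{1}(ger0_norm (ltW k0)) -normrM mulrBl.
  move: b1 b2; rewrite e intrD => b1 b2; move: a2; rewrite intrD => a2.
  by rewrite ler_norml; lra.
apply: (@measurable_uniform_limit _ _ `|C|
  (fun k (p : U * T) => g (rep k (key k (X p.1))) p.2)); last first.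
  move=> k p; apply: le_trans (gC _ _ p.2 (KX _) (repP k p.1).1) _.
  by rewrite (le_trans (ler_wpM2r (normr_ge0 _) (ler_norm C)))// ler_wpM2l.
move=> k.
pose h (c : {ffun 'I_n -> int}) (p : U * T) :=
  if pselect (K (rep k c)) then g (rep k c) p.2 else 0.
rewrite (_ : (fun _ => _) = fun p => h (key k (X p.1)) p); last first.
  by apply/funext => p; rewrite /h; case: (pselect (K (rep k _))) => // -[]; case: (repP k p.1).
apply: measurable_pieces => c; last first.
  rewrite /h; case: (pselect (K (rep k c))) => [Kc|nKc] /=; last exact: measurable_cst.
  exact: measurableT_comp (mg _ Kc) measurable_snd.
have -> : (fun p : U * T => key k (X p.1)) @^-1` [set c] =
    \bigcap_(i in [set: 'I_n]) [set p | Num.floor (X p.1 0 i * k.+1%:R) = c i].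
  apply/seteqP; split => p /=.
    by move=> <- i _; rewrite /key ffunE.
  by move=> pc; apply/ffunP => i; rewrite ffunE; exact: pc.
apply: fin_bigcap_measurable => // i _.
apply: (@measurable_floor _ _ (fun p : U * T => X p.1 0 i * k.+1%:R)).
apply: measurable_funM; last exact: measurable_cst.
exact: (measurableT_comp (mX i) measurable_fst).
Qed.

End Measurability.

(** * The partition encoding *)

Section Encoding.
Context {R : realType}.
Implicit Types (s : nat) (r u a n : R).

Let U := uniform_prob (@ltr01 R).

Lemma partition_level_near s r u : (0 < s)%N -> 0 <= r <= 1 ->
  `|partition_level s r u - r| <= s%:R^-1.
Proof.
move=> s0 r01; have s0' : 0 < s%:R :> R by rewrite ltr0n.
have [_ /andP[]] := partition_indexP s0 r01.
rewrite ler_pdivrMr// ler_pdivlMr// -natr1 /partition_level.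
set l := (partition_index s r)%:R => lr rl.
rewrite -(ler_pM2r s0') mulVf ?gt_eqF// -[X in _ * X <= _](ger0_norm (ltW s0')).
rewrite -normrM mulrBl divfK ?gt_eqF// natrD -/l ler_norml.
by case: (u < _) => /=; lra.
Qed.

Lemma partition_level_itv s r u : (0 < s)%N -> 0 <= r <= 1 ->
  0 <= partition_level s r u <= 1.
Proof.
move=> s0 r01; have s0' : 0 < s%:R :> R by rewrite ltr0n.
have [ls _] := partition_indexP s0 r01.
rewrite /partition_level divr_ge0//= ler_pdivrMr// mul1r ler_nat.
by case: (u < _); rewrite ?addn1 ?addn0// ltnW.
Qed.

Lemma partition_level_measurable s d (T : measurableType d) (r : T -> R) (u : T -> R) :
  measurable_fun setT r -> measurable_fun setT u ->
  measurable_fun setT (fun x => partition_level s (r x) (u x)).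
Proof.
move=> mr mu; rewrite /partition_level; apply: measurable_funM => //.
have mindex : measurable_fun setT (fun x => (partition_index s (r x))%:R : R).
  apply: (measurableT_comp (f := fun r : R => (partition_index s r)%:R : R)) => //.
  apply: nondecreasing_measurable => // a b ab.
  rewrite ler_nat /partition_index leq_min geq_minr andbT geq_min le_truncn//.
  by rewrite ler_wpM2r.
under eq_fun do rewrite natrD; apply: measurable_funD => //.
rewrite (_ : (fun x => _) = fun x => if u x < r x * s%:R - (partition_index s (r x))%:R
  then 1 else 0 : R); last by apply/funext => x; case: ifP.
apply: measurable_fun_ifT => //; apply: measurable_fun_ltr => //.
by apply: measurable_funB => //; exact: measurable_funM.
Qed.

Lemma partition_level_bmeas s d (T : measurableType d) (r : T -> R) (u : T -> R) :
  (0 < s)%N -> (forall x, 0 <= r x <= 1) ->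
  measurable_fun setT r -> measurable_fun setT u ->
  bmeas (fun x => partition_level s (r x) (u x)).
Proof.
move=> s0 r01 mr mu; split; first exact: partition_level_measurable.
exists 1 => x; have /andP[l0 l1] := partition_level_itv (u x) s0 (r01 x).
by rewrite ger0_norm.
Qed.

(** The level is [l / s] plus [1 / s] on the event of rounding up, and that event
    has probability [r s - l] exactly. *)
Lemma partition_level_unbiased s r : (0 < s)%N -> 0 <= r <= 1 ->
  \int[U]_u (partition_level s r u - r) = 0.
Proof.
move=> s0 r01; have s0' : s%:R != 0 :> R by rewrite pnatr_eq0 -lt0n.
have [_] := partition_level_law s0 r01; rewrite -/U.
set l := partition_index s r; set E := [set u | _] => UE.
have levelE u : partition_level s r u - r = s%:R^-1 * \1_E u + (l%:R / s%:R - r).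
  rewrite indicE /E /partition_level -/l addrA; congr (_ - _).
  rewrite natrD mulrDl addrC; congr (_ + _); rewrite mulrC; congr (_ * _).
  congr (_%:R); congr (nat_of_bool _).
  apply/idP/idP => [h|]; first by apply/mem_set; rewrite /= h addn1.
  move/set_mem => /= /(congr1 (fun x => x * s%:R)); rewrite !divfK// => /eqP.
  by rewrite eqr_nat; case: (u < _) => //; rewrite addn0 -{1}(addn0 l) -addn1 eqn_add2l.
have mE : measurable E.
  rewrite /E; pose g u := partition_level s r u.
  have mg : measurable_fun setT g.
    by apply: partition_level_measurable => //; exact: measurable_cst.
  by have := mg measurableT [set l.+1%:R / s%:R] (measurable_set1 _); rewrite setTI.
have b1 : bmeas (\1_E : _ -> R).
  split; first exact: measurable_indic.
  by exists 1 => u; rewrite indicE; case: (_ \in _); rewrite ?normr1 ?normr0.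
under eq_Rintegral do rewrite levelE.
rewrite mean_add ?mean_scale ?mean_cst//; [|exact: bmeasZ|exact: bmeas_cst].
rewrite /Rintegral integral_indic// setIT [X in fine X](_ : _ = (r * s%:R - l%:R)%:E)//=.
by field.
Qed.

(** Coordinate of a decoded vector as a function of the original coordinate [a],
    the norm [n] and the draw, so that the encoding can be studied one scalar at
    a time. *)
Definition decode_coord s n a u := Num.sg a * partition_level s (`|a| / n) u * n.

Lemma ratio_itv n a : `|a| <= n -> 0 <= `|a| / n <= 1.
Proof.
move=> an; have n0 : 0 <= n by apply: le_trans an.
rewrite divr_ge0//=; have [->|nn] := eqVneq n 0; first by rewrite invr0 mulr0.
by rewrite ler_pdivrMr ?mul1r// lt_neqAle eq_sym nn.
Qed.

Lemma decode_coordE s n a u : `|a| <= n ->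
  decode_coord s n a u - a =
  Num.sg a * (partition_level s (`|a| / n) u - `|a| / n) * n.
Proof.
move=> an; rewrite /decode_coord mulrBr mulrBl; congr (_ - _).
have [n0|nn] := eqVneq n 0.
  by move: an; rewrite n0 normr_le0 => /eqP ->; rewrite mulr0.
by rewrite mulrA divfK// mulr_sg_norm.
Qed.

(** This deterministic bound is the only estimate of the variance of the encoding
    that the convergence rate needs. *)
Lemma decode_coord_near s n a u : (0 < s)%N -> `|a| <= n ->
  `|decode_coord s n a u - a| <= n / s%:R.
Proof.
move=> s0 an; have n0 : 0 <= n by apply: le_trans an.
rewrite decode_coordE// !normrM (ger0_norm n0) mulrC ler_wpM2l//.
rewrite -[leRHS]mul1r ler_pM//; first by rewrite normr_sg; case: (_ != _).
by apply: partition_level_near => //; exact: ratio_itv.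
Qed.

Lemma decode_coord_le s n a u : (0 < s)%N -> `|a| <= n ->
  `|decode_coord s n a u| <= n.
Proof.
move=> s0 an; have n0 : 0 <= n by apply: le_trans an.
have /andP[l0 l1] := partition_level_itv u s0 (ratio_itv an).
rewrite /decode_coord normrM [X in X * _]normrM (ger0_norm n0) (ger0_norm l0) -[leRHS]mul1r ler_wpM2r//.
by rewrite -[leRHS]mul1r ler_pM// normr_sg; case: (_ != _).
Qed.

(* [U] is a measure for the sigma-algebra generated by the half-open intervals,
   whereas the draws take values in the reals with their standard measurable
   structure; the identity transports it. *)
Let draw_type : measurableType _ := measurableTypeR R.
Let draw_id : draw_type -> R := id.
Let draw_id_measurable : measurable_fun setT draw_id.
Proof. by move=> _ B mB; rewrite setTI. Qed.
HB.instance Definition _ := isMeasurableFun.Build _ _ draw_type R draw_id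
  draw_id_measurable.

Definition unit_uniform : probability R R :=
  distribution U [the {mfun draw_type >-> R} of draw_id].

Lemma unit_uniform_mean (g : R -> R) : bmeas g ->
  \int[unit_uniform]_r g r = \int[U]_r g r.
Proof.
move=> bg; rewrite /Rintegral integral_distribution//.
  by case: bg => /measurable_EFinP.
exact: bmeas_integrable (bmeas_comp draw_id_measurable bg).
Qed.

Lemma decode_coord_unbiased s n a : (0 < s)%N -> `|a| <= n ->
  \int[unit_uniform]_u (decode_coord s n a u - a) = 0.
Proof.
move=> s0 an; rewrite unit_uniform_mean; last first.
  apply: bmeasB; last exact: bmeas_cst.
  split; last by exists n => r; exact: decode_coord_le.
  by apply: measurable_funM => //; apply: measurable_funM => //;
    apply: partition_level_measurable.
under eq_Rintegral do rewrite decode_coordE// mulrC mulrA.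
rewrite mean_scale ?partition_level_unbiased ?mulr0//; first exact: ratio_itv.
apply: bmeasB; last exact: bmeas_cst.
apply: partition_level_bmeas => // _; exact: ratio_itv.
Qed.

Lemma measurable_sg : measurable_fun setT (@Num.sg R).
Proof.
apply: nondecreasing_measurable => // a b ab.
by case: (sgrP a) => ha; case: (sgrP b) => hb //; rewrite ?lerN10//; lra.
Qed.

Lemma decode_coord_measurable s d (T : measurableType d) (n a u : T -> R) :
  (forall x, `|a x| <= n x) ->
  measurable_fun setT n -> measurable_fun setT a -> measurable_fun setT u ->
  measurable_fun setT (fun x => decode_coord s (n x) (a x) (u x)).
Proof.
move=> an mn ma mu; apply: measurable_funM => //; apply: measurable_funM.
  exact: (measurableT_comp measurable_sg).
apply: partition_level_measurable => //; apply: measurable_funM.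
  exact: measurableT_comp.
rewrite (_ : (fun _ => _) = fun x => n x `^ (-1)); last first.
  by apply/funext => x; rewrite powR_inv1// (le_trans _ (an x)).
exact: (measurableT_comp (measurable_powR _)).
Qed.

Lemma norm_measurable d (T : measurableType d) k (X : T -> 'rV[R]_k) :
  (forall i, measurable_fun setT (fun x => X x 0 i)) ->
  measurable_fun setT (fun x => `|X x|).
Proof.
move=> mX.
have := @lipschitz_joint_measurable R _ _ T unit k setT 1 X
  (fun y _ => `|y|) (fun=> I) mX.
move=> /(_ _ _)/(measurableT_comp (f := fun p : T * unit => `|X p.1|)) H.
apply: (H _ _ _ (fun x => (x, tt))).
- by move=> y y' _ _ _; rewrite mul1r; exact: ler_dist_dist.
- by move=> y _; exact: measurable_cst.
- by apply: measurable_fun_pair => //; exact: measurable_cst.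
Qed.

End Encoding.

(** * Euclidean geometry, gradients and convexity *)

Section Euclidean.
Context {R : realType} {d : nat}.
Implicit Types (x y w : 'rV[R]_d) (a : R) (K : set 'rV[R]_d).

Lemma dotC x y : dot x y = dot y x.
Proof. by apply: eq_bigr => i _; rewrite mulrC. Qed.

Lemma dotDl x y w : dot (x + y) w = dot x w + dot y w.
Proof. by rewrite -big_split; apply: eq_bigr => i _; rewrite mxE mulrDl. Qed.

Lemma dotZl a x y : dot (a *: x) y = a * dot x y.
Proof. by rewrite mulr_sumr; apply: eq_bigr => i _; rewrite mxE mulrA. Qed.

Lemma dotNl x y : dot (- x) y = - dot x y.
Proof. by rewrite -scaleN1r dotZl mulN1r. Qed.

Lemma dotBl x y w : dot (x - y) w = dot x w - dot y w.
Proof. by rewrite dotDl dotNl. Qed.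

Lemma dotZr a x y : dot x (a *: y) = a * dot x y.
Proof. by rewrite !(dotC x) dotZl. Qed.

Lemma dotBr x y w : dot w (x - y) = dot w x - dot w y.
Proof. by rewrite !(dotC w) dotBl. Qed.

Lemma dot_ge0 x : 0 <= dot x x.
Proof. by apply: sumr_ge0 => i _; rewrite -expr2 sqr_ge0. Qed.

Lemma enorm_ge0 x : 0 <= enorm x. Proof. exact: sqrtr_ge0. Qed.

Lemma enorm_sqr x : enorm x ^+ 2 = dot x x.
Proof. by rewrite sqr_sqrtr// dot_ge0. Qed.

Lemma enorm_sqr_sum x : enorm x ^+ 2 = \sum_(i < d) (x 0 i) ^+ 2.
Proof. by rewrite enorm_sqr. Qed.

Lemma enormZ a x : enorm (a *: x) = `|a| * enorm x.
Proof.
by rewrite /enorm dotZl dotZr mulrA -expr2 sqrtrM ?sqr_ge0// sqrtr_sqr.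
Qed.

Lemma coord_le_enorm x i : `|x 0 i| <= enorm x.
Proof.
rewrite -sqrtr_sqr ler_wsqrtr// /dot (bigD1 i)//= -expr2 lerDl.
by apply: sumr_ge0 => j _; rewrite -expr2 sqr_ge0.
Qed.

Lemma norm_le_enorm x : `|x| <= enorm x.
Proof. by apply: norm_le_coord; [exact: enorm_ge0|exact: coord_le_enorm]. Qed.

Lemma enorm_sqr_le x (c : R) : (forall i, `|x 0 i| <= c) ->
  enorm x ^+ 2 <= d%:R * c ^+ 2.
Proof.
move=> xc; rewrite enorm_sqr_sum.
have -> : d%:R * c ^+ 2 = \sum_(i < d) c ^+ 2 by rewrite sumr_const card_ord mulr_natl.
apply: ler_sum => i _; rewrite -(real_normK (num_real (x 0 i))) lerXn2r// ?nnegrE//.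
exact: le_trans (xc i).
Qed.

Lemma enorm_le_norm x : enorm x <= Num.sqrt d%:R * `|x|.
Proof.
rewrite -(ger0_norm (enorm_ge0 x)) -sqrtr_sqr.
rewrite -[X in _ <= _ * X]normr_id -sqrtr_sqr -sqrtrM// ler_wsqrtr//.
by apply: enorm_sqr_le; exact: coord_le_norm.
Qed.

Lemma enorm_eq0 x : enorm x = 0 -> x = 0.
Proof.
move=> x0; apply/rowP => i; rewrite mxE; apply/eqP.
by rewrite -normr_le0 -x0 coord_le_enorm.
Qed.

Lemma cauchy_schwarz x y : dot x y <= enorm x * enorm y.
Proof.
have [y0|y0] := eqVneq (enorm y) 0.
  by rewrite y0 mulr0 (enorm_eq0 y0) -(scale0r 0) dotZr mul0r.
have yy : 0 < dot y y.
  by rewrite -enorm_sqr exprn_gt0// lt_neqAle eq_sym y0 enorm_ge0.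
have h : 0 <= dot y y * (dot y y * dot x x - dot x y ^+ 2).
  have := dot_ge0 (dot y y *: x - dot x y *: y).
  rewrite !(dotBl, dotBr, dotZl, dotZr) (dotC y x) => h; apply: (le_trans h).
  by rewrite le_eqVlt; apply/orP; left; apply/eqP; ring.
move: h; rewrite pmulr_rge0// subr_ge0 -!enorm_sqr -exprMn mulrC => h.
rewrite (le_trans (ler_norm _))// -sqrtr_sqr.
have -> : enorm x * enorm y = Num.sqrt ((enorm x * enorm y) ^+ 2).
  by rewrite sqrtr_sqr ger0_norm// mulr_ge0// enorm_ge0.
exact: ler_wsqrtr.
Qed.

Lemma diameter_ge K x y : compact K -> K x -> K y -> enorm (x - y) <= diameter K.
Proof.
move=> cK Kx Ky; apply: sup_upper_bound; last by exists x => //; exists y.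
split; first by exists (enorm (x - y)); exists x => //; exists y.
have [M [_ KM]] := compact_bounded cK.
pose B : R := `|M| + 1.
have KB u : K u -> `|u| <= B.
  by apply: KM; rewrite (le_lt_trans (ler_norm M))// ltrDl.
exists (Num.sqrt (d%:R * (B + B) ^+ 2)) => _ [u Ku [v Kv <-]].
rewrite -(ger0_norm (enorm_ge0 _)) -sqrtr_sqr ler_wsqrtr//.
apply: enorm_sqr_le => i; apply: le_trans (coord_le_norm _ _) _.
by apply: le_trans (ler_normB _ _) _; rewrite lerD// KB.
Qed.

Implicit Types f : 'rV[R]_d -> R.

Lemma derive_grad f x v : differentiable f x -> 'D_v f x = dot (grad f x) v.
Proof.
move=> df; rewrite deriveE//.
have {1}-> : v = \sum_(i < d) v 0 i *: delta_mx 0 i.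
  by rewrite {1}(matrix_sum_delta v) big_ord1.
rewrite linear_sum; apply: eq_bigr => i _.
by rewrite linearZ /= /grad mxE deriveE// mulrC.
Qed.

Lemma grad_mean n (f : 'I_n -> 'rV[R]_d -> R) (c : R) x :
  (forall j, differentiable (f j) x) ->
  grad (fun y => (\sum_(j < n) f j y) / c) x = c^-1 *: \sum_(j < n) grad (f j) x.
Proof.
move=> df; apply/rowP => i; rewrite !mxE summxE.
rewrite (_ : (fun y => _) = c^-1 *: \sum_(j < n) f j); last first.
  by apply/funext => y; rewrite fctE fct_sumE /= mulrC.
rewrite deriveZ ?derive_sum.
- by congr (_ * _); apply: eq_bigr => j _; rewrite mxE.
- by move=> j; exact: diff_derivable.
- by apply: derivable_sum => j; exact: diff_derivable.
Qed.

Lemma is_derive_line f x v (s : R) : differentiable f (x + s *: v) ->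
  is_derive s 1 (fun s => f (x + s *: v)) (dot (grad f (x + s *: v)) v).
Proof.
move=> df; have := diff_derivable (v := v) df; rewrite -derive_grad//.
rewrite /derivable /derive.
set g1 := fun h => h^-1 *: _; move=> cg1.
have E : (fun h : R => h^-1 *: ((fun s => f (x + s *: v)) (h *: 1 + s) -
     (fun s => f (x + s *: v)) s)) = g1.
  apply/funext => h; rewrite /g1 /=; congr (_ *: (f _ - _)).
  by rewrite [_%:A]mulr1 scalerDl addrCA.
apply: DeriveDef; first by rewrite /derivable E.
by rewrite /derive E.
Qed.

Lemma convex_line K x y (s : R) : convex_set K -> K x -> K y ->
  0 <= s -> s <= 1 -> K (x + s *: (y - x)).
Proof.
move=> cK Kx Ky s0 s1.
have s01 : Itv.spec (@Itv.num_sem R) (Itv.Real `[0%Z, 1%Z]) s.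
  by apply/and3P; split => //; rewrite ?num_real//= in_itv/= s0 s1.
have := cK y x (Itv.mk s01) (mem_set Ky) (mem_set Kx).
rewrite inE; congr (K _).
rewrite /conv /= scalerBr scalerBl scale1r.
by rewrite addrCA.
Qed.

(** By convexity the difference quotients of [f] from [x] towards [y] are at most
    [f y - f x] on ]0, 1[; the directional derivative is their limit. *)
Lemma convex_gradient K f x y : convex_set K -> convex_function K f ->
  K x -> K y -> differentiable f x -> f x + dot (grad f x) (y - x) <= f y.
Proof.
move=> cK cf Kx Ky df; rewrite -derive_grad// addrC -lerBrDr.
rewrite leNgt; apply/negP => lt.
have := diff_derivable (v := y - x) df; rewrite /derivable /derive in lt *.
move=> /cvg_ex[l Dl]; move: lt; rewrite (cvg_lim _ Dl)// => lt.
have /cvg_dnbhs_at_right/cvgrPdist_lt := Dl.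
move=> /(_ (l - (f y - f x))); rewrite subr_gt0 => /(_ lt) near_l.
have [h] : exists h : R, [/\ 0 < h, h < 1 &
  `|l - h^-1 *: (f (h *: (y - x) + x) - f x)| < l - (f y - f x)].
  by near (0 : R)^'+ => h; exists h; split => //; near: h.
move=> [h0 h1]; apply/negP; rewrite -leNgt.
apply: le_trans (ler_norm _); rewrite lerB// /GRing.scale /= mulrC ler_pdivrMr//.
have h01 : Itv.spec (@Itv.num_sem R) (Itv.Real `[0%Z, 1%Z]) h.
  by apply/and3P; split => //=; rewrite ?num_real ?bnd_simp ?ltW//.
have := cf (Itv.mk h01) y x (mem_set Ky) (mem_set Kx).
rewrite convRE /conv /= => H.
have -> : h *: (y - x) + x = h *: y + (1 - h) *: x.
  by rewrite scalerBr scalerBl scale1r addrAC addrA.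
by apply: le_trans (lerB H (lexx _)) _; rewrite /unstable.onem; lra.
Unshelve. all: by end_near.
Qed.

(** Along the segment, subtract from [f] its first-order part and the quadratic
    [L / 2 s^2 |y - x|^2]: the derivative of what remains is nonpositive by
    Cauchy-Schwarz and the Lipschitz bound, and the mean value theorem
    concludes. *)
Lemma descent K f (L : R) x y : convex_set K -> smooth_on K L f ->
  K x -> K y ->
  f y <= f x + dot (grad f x) (y - x) + L / 2 * enorm (y - x) ^+ 2.
Proof.
move=> cK [df Lf] Kx Ky.
set v := y - x; set n := enorm v ^+ 2; set g0 := dot (grad f x) v.
pose psi (s : R) : R := f (x + s *: v) - (s * g0 + L / 2 * n * s ^+ 2).
pose dpsi (s : R) : R := dot (grad f (x + s *: v)) v - (g0 + L * n * s).
have Ks (s : R) : 0 <= s <= 1 -> K (x + s *: v).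
  by move=> /andP[s0 s1]; exact: convex_line.
have dpsiP (s : R) : 0 <= s <= 1 -> is_derive s 1 psi (dpsi s).
  move=> s01; have h1 := is_derive_line (df _ (Ks s s01)).
  have h2 : is_derive s 1 (g0 *: (@id R) + (L / 2 * n) *: ((@id R) ^+ 2))
      (g0 + L * n * s).
    by apply: is_derive_eq; rewrite /GRing.scale /=; field.
  have -> : psi = (fun s : R => f (x + s *: v)) -
      (g0 *: (@id R) + (L / 2 * n) *: ((@id R) ^+ 2)).
    by apply/funext => r; rewrite /psi !fctE /GRing.scale /= (mulrC r).
  exact: (is_deriveB h1 h2).
have [c] : exists2 c, c \in `]0, 1[%R & psi 1 - psi 0 = dpsi c * (1 - 0).
  apply: MVT => //.
    by move=> s; rewrite in_itv/= => /andP[s0 s1]; apply: dpsiP; rewrite !ltW.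
  apply: derivable_within_continuous => s; rewrite in_itv/= => s01.
  by have [] := dpsiP s s01.
rewrite in_itv/= => /andP[c0 c1].
have : dpsi c <= 0.
  rewrite /dpsi opprD addrA -dotBl subr_le0.
  apply: le_trans (cauchy_schwarz _ _) _.
  have Kc : K (x + c *: v) by apply: Ks; rewrite !ltW.
  apply: le_trans (ler_wpM2r (enorm_ge0 _) (Lf _ _ Kc Kx)) _.
  rewrite addrC addKr enormZ gtr0_norm// /n expr2.
  by rewrite le_eqVlt; apply/orP; left; apply/eqP; ring.
rewrite /psi scale1r scale0r addr0 [x + v](_ : _ = y); last by rewrite addrC subrK.
lra.
Qed.

End Euclidean.

(** * The expected objective *)

Section Objective.
Context {R : realType} {d : nat} {dZ : measure_display} {Z : measurableType dZ}.
Variables (K : set 'rV[R]_d) (L sigma Ginf : R).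
Variables (P : probability Z R) (ft : 'rV[R]_d -> Z -> R).
Let f := fun x : 'rV[R]_d => fine ('E_P[ft x])%E.

Hypothesis L_gt0 : 0 < L.
Hypothesis K_convex : convex_set K.
Hypothesis ft_convex : forall zeta, convex_function K (ft ^~ zeta).
Hypothesis ft_smooth : forall zeta, smooth_on K L (ft ^~ zeta).
Hypothesis ft_integrable : forall y, K y -> P.-integrable setT (EFin \o ft y).
Hypothesis f_diff : forall y, K y -> differentiable f y.
Hypothesis grad_unbiased : forall y i, K y ->
  P.-integrable setT (fun zeta => (grad (ft ^~ zeta) y 0 i)%:E) /\
  ('E_P[fun zeta => (grad (ft ^~ zeta) y 0 i)%R] = (grad f y 0 i)%R%:E)%E.
Hypothesis grad_bounded : forall y zeta, K y -> `|grad (ft ^~ zeta) y| <= Ginf.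

Lemma sample_grad_bmeas y i : K y -> bmeas (fun zeta => grad (ft ^~ zeta) y 0 i).
Proof.
move=> Ky; have [/integrableP[/measurable_EFinP mg _] _] := grad_unbiased i Ky.
split => //; exists Ginf => zeta.
exact: le_trans (coord_le_norm _ _) (grad_bounded _ Ky).
Qed.

Lemma sample_grad_mean y i : K y ->
  \int[P]_zeta grad (ft ^~ zeta) y 0 i = grad f y 0 i.
Proof.
by move=> Ky; have [_] := grad_unbiased i Ky; rewrite unlock /Rintegral => ->.
Qed.

Lemma sample_dot_mean y w : K y ->
  \int[P]_zeta dot (grad (ft ^~ zeta) y) w = dot (grad f y) w.
Proof.
move=> Ky; rewrite /dot.
under eq_Rintegral do under eq_bigr do rewrite mulrC.
rewrite mean_sum; last by move=> i; apply: bmeasZ; exact: sample_grad_bmeas.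
apply: eq_bigr => i _; rewrite mean_scale; last exact: sample_grad_bmeas.
by rewrite sample_grad_mean// mulrC.
Qed.

Lemma sample_dot_bmeas y w : K y -> bmeas (fun zeta => dot (grad (ft ^~ zeta) y) w).
Proof.
move=> Ky; apply: bmeas_sum => i; apply: bmeasM; last exact: bmeas_cst.
exact: sample_grad_bmeas.
Qed.

(** The gradient of [f] is the mean of the stochastic gradients. Testing the
    difference of two gradients against itself turns its squared norm into a mean
    of scalar products, which Cauchy-Schwarz bounds sample by sample. *)
Lemma objective_smooth : smooth_on K L f.
Proof.
split => // x y Kx Ky.
set w := grad f x - grad f y.
have [->|w0] := eqVneq (enorm w) 0.
  by rewrite mulr_ge0// ?enorm_ge0// ltW.
have wgt : 0 < enorm w by rewrite lt_neqAle eq_sym w0 enorm_ge0.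
rewrite -(ler_pM2r wgt) -expr2 enorm_sqr {1}/w dotBl -!sample_dot_mean//.
rewrite -mean_sub; [|exact: sample_dot_bmeas|exact: sample_dot_bmeas].
rewrite -[leRHS](mean_cst P); apply: mean_mono => [||zeta]; last first.
- rewrite -dotBl; apply: le_trans (cauchy_schwarz _ _) _.
  by rewrite ler_wpM2r ?enorm_ge0//; apply: (ft_smooth zeta).2.
- exact: bmeas_cst.
- by apply: bmeasB; exact: sample_dot_bmeas.
Qed.

Lemma objective_convex : convex_function K f.
Proof.
move=> t x y xK yK; have [Kx Ky] : K x /\ K y by split; exact: set_mem.
have Kc : K (conv t x y) by apply/set_mem; exact: K_convex.
have fE y' : f y' = \int[P]_zeta ft y' zeta by rewrite /f unlock.
rewrite convRE !fE -!RintegralZl// ?ft_integrable//; try exact: ft_integrable.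
have iZ c y' : K y' -> P.-integrable setT (EFin \o (fun zeta => c * ft y' zeta)).
  move=> Ky'; rewrite (_ : _ \o _ = (fun zeta => c%:E * (EFin \o ft y') zeta)%E)//.
  by apply: integrableZl => //; exact: ft_integrable.
rewrite -RintegralD//; try exact: iZ.
apply: le_Rintegral => //; first exact: ft_integrable.
  rewrite (_ : _ \o _ = (EFin \o (fun zeta => t%:num * ft x zeta)%R) \+
    (EFin \o (fun zeta => unstable.onem t%:num * ft y zeta)%R))%E//.
  by apply: integrableD => //; exact: iZ.
by move=> zeta _; have := ft_convex zeta t xK yK; rewrite convRE.
Qed.

Lemma objective_grad_le y i : K y -> `|grad f y 0 i| <= Ginf.
Proof.
move=> Ky; rewrite -sample_grad_mean//.
have bg := sample_grad_bmeas i Ky.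
apply: le_trans (le_normr_Rintegral measurableT (bmeas_integrable P bg)) _.
rewrite -[leRHS](mean_cst P); apply: mean_mono => [||zeta].
- case: bg => mg [C gC]; split; first exact: measurableT_comp.
  by exists C => zeta; rewrite normr_id.
- exact: bmeas_cst.
- exact: le_trans (coord_le_norm _ _) (grad_bounded _ Ky).
Qed.

(** Both one-sided bounds are first-order convexity inequalities, at [x] and at
    [y], together with the bound on the gradient. *)
Lemma objective_lipschitz x y : K x -> K y ->
  `|f x - f y| <= (d%:R * Ginf) * `|x - y|.
Proof.
move=> Kx Ky.
have dot_le x' y' : K x' -> `|dot (grad f x') (y' - x')| <= d%:R * Ginf * `|y' - x'|.
  move=> Kx'; apply: le_trans (ler_norm_sum _ _ _) _.
  have -> : d%:R * Ginf * `|y' - x'| = \sum_(i < d) Ginf * `|y' - x'|.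
    by rewrite sumr_const card_ord -[RHS]mulr_natl mulrA.
  apply: ler_sum => i _; rewrite normrM ler_pM//; first exact: objective_grad_le.
  exact: coord_le_norm.
have cg := convex_gradient K_convex objective_convex.
have h1 := cg _ _ Kx Ky (f_diff Kx); have h2 := cg _ _ Ky Kx (f_diff Ky).
have := dot_le _ y Kx; have := dot_le _ x Ky.
rewrite (distrC y x) !ler_norml => /andP[a1 a2] /andP[b1 b2].
by apply/andP; split; lra.
Qed.

Lemma sample_grad_lipschitz i zeta x y : K x -> K y ->
  `|grad (ft ^~ zeta) x 0 i - grad (ft ^~ zeta) y 0 i|
    <= (L * Num.sqrt d%:R) * `|x - y|.
Proof.
move=> Kx Ky; have := coord_le_enorm (grad (ft ^~ zeta) x - grad (ft ^~ zeta) y) i.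
rewrite !mxE => h; apply: (le_trans h).
apply: (le_trans ((ft_smooth zeta).2 _ _ Kx Ky)); rewrite -mulrA ler_wpM2l ?(ltW L_gt0)//.
exact: enorm_le_norm.
Qed.

Lemma objective_grad_lipschitz i x y : K x -> K y ->
  `|grad f x 0 i - grad f y 0 i| <= (L * Num.sqrt d%:R) * `|x - y|.
Proof.
move=> Kx Ky; have := coord_le_enorm (grad f x - grad f y) i.
rewrite !mxE => h; apply: (le_trans h).
apply: (le_trans (objective_smooth.2 _ _ Kx Ky)); rewrite -mulrA ler_wpM2l ?(ltW L_gt0)//.
exact: enorm_le_norm.
Qed.

End Objective.

(** * The error of the gradient estimate in one round *)

Local Arguments qfw_x : simpl never.
Local Arguments grad_est : simpl never.

Section SourceSigma.
Context {dO : measure_display} {Omega : measurableType dO} {R : realType}.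
Context {dZ : measure_display} {Z : measurableType dZ} {M d : nat}.
Variables (Pr : probability Omega R).
Variables (z : nat -> 'I_M -> nat -> {RV Pr >-> Z}).
Variables (u : nat -> 'I_M -> 'I_d -> {RV Pr >-> R}).
Variables (w : nat -> 'I_d -> {RV Pr >-> R}).

Lemma sigma_ofT d' (T : measurableType d') (X : Omega -> T) : sigma_of X setT.
Proof. by exists setT => //; rewrite setTI preimage_setT. Qed.

Lemma sigma_ofI d' (T : measurableType d') (X : Omega -> T) :
  setI_closed (sigma_of X).
Proof.
move=> _ _ [B mB <-] [B' mB' <-]; exists (B `&` B'); first exact: measurableI.
by rewrite !setTI preimage_setI.
Qed.

Lemma sigma_of_measurable d' (T : measurableType d') (X : {RV Pr >-> T}) :
  sigma_of X `<=` measurable.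
Proof. by move=> _ [B mB <-]; exact: (measurable_funPT X). Qed.

Lemma source_sigmaT a : source_sigma z u w a setT.
Proof. by case: a => *; exact: sigma_ofT. Qed.

Lemma source_sigmaI a : setI_closed (source_sigma z u w a).
Proof. by case: a => *; exact: sigma_ofI. Qed.

Lemma source_sigma_measurable a : source_sigma z u w a `<=` measurable.
Proof. by case: a => *; exact: sigma_of_measurable. Qed.

End SourceSigma.

Section Rounds.
Context {R : realType} {d M : nat} {dZ : measure_display} {Z : measurableType dZ}.
Context {dO : measure_display} {Omega : measurableType dO}.
Variables (Pr : probability Omega R) (P : probability Z R).
Variables (K : set 'rV[R]_d) (L sigma Ginf : R) (ft : 'rV[R]_d -> Z -> R).
Variables (p : nat -> nat) (S s1 s2 : nat -> nat -> nat).
Variables (eta : nat -> nat -> R) (x1 : 'rV[R]_d).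
Variables (z : nat -> 'I_M -> nat -> {RV Pr >-> Z}).
Variables (u : nat -> 'I_M -> 'I_d -> {RV Pr >-> R}).
Variables (w : nat -> 'I_d -> {RV Pr >-> R}).
Variables (v : nat -> Omega -> 'rV[R]_d).
Let f := fun x : 'rV[R]_d => fine ('E_P[ft x])%E.
Let F := source_sigma z u w.
Let x t om := qfw_x p eta x1 (fun t' => v t' om) t.
Let gbar t om := grad_est ft p S s1 s2 eta x1
  (fun t' m j => z t' m j om) (fun t' m i => u t' m i om)
  (fun t' i => w t' i om) (fun t' => v t' om) t.

Hypothesis M_gt0 : (0 < M)%N.
Hypothesis L_gt0 : 0 < L.
Hypothesis ft_smooth : forall zeta, smooth_on K L (ft ^~ zeta).
Hypothesis f_diff : forall y, K y -> differentiable f y.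
Hypothesis grad_unbiased : forall y i, K y ->
  P.-integrable setT (fun zeta => (grad (ft ^~ zeta) y 0 i)%:E) /\
  ('E_P[fun zeta => (grad (ft ^~ zeta) y 0 i)%R] = (grad f y 0 i)%R%:E)%E.
Hypothesis grad_variance : forall y, K y ->
  ('E_P[fun zeta => (enorm (grad (ft ^~ zeta) y - grad f y) ^+ 2)%R]
    <= (sigma ^+ 2)%:E)%E.
Hypothesis grad_bounded : forall y zeta, K y -> `|grad (ft ^~ zeta) y| <= Ginf.
Hypothesis z_law : forall t m j (B : set Z), measurable B ->
  distribution Pr (z t m j) B = P B.
Hypothesis u_law : forall t m i (B : set R), measurable B ->
  distribution Pr (u t m i) B = uniform_prob (@ltr01 R) B.
Hypothesis w_law : forall t i (B : set R), measurable B ->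
  distribution Pr (w t i) B = uniform_prob (@ltr01 R) B.
Hypothesis F_independent : mutually_independent Pr F.

Let FT := @source_sigmaT _ _ _ _ _ _ _ Pr z u w.
Let FI := @source_sigmaI _ _ _ _ _ _ _ Pr z u w.
Let Fm := @source_sigma_measurable _ _ _ _ _ _ _ Pr z u w.
Let fresh_sum d' (T : measurableType d') :=
  @fresh_sum_pythagoras _ _ _ Pr _ F FT FI Fm F_independent d' T.
Let fresh_one := @fresh_pythagoras _ _ _ Pr _ F FT FI Fm F_independent.

Definition upto (t : nat) : set (source M d) :=
  [set a | (source_round a <= t)%N].

Section OneRound.
Variable t : nat.
Let st := period_start p t.+1.
Let n := at_round p S t.+1.
Let a1 := at_round p s1 t.+1.
Let a2 := at_round p s2 t.+1.
Let A0 := upto t.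
(** Within a round the workers first sample, then encode, then the master encodes.
    The layers of information [upto t], [after_samples] and [after_workers] follow
    this order: each noise is a function of one layer and of sources outside of
    it. *)
Definition after_samples : set (source M d) :=
  upto t `|` [set a | exists m j, a = Sample d t.+1 m j].
Definition after_workers : set (source M d) :=
  after_samples `|` [set a | exists m i, a = WorkerDraw t.+1 m i].

(** What a round measures of the function [h]: its value at the iterate when a
    period starts, and its change since the previous iterate otherwise. Both
    kinds of rounds then have the same analysis. *)
Definition increment (V : zmodType) (h : 'rV[R]_d -> V) (om : Omega) : V :=
  if st then h (x t.+1 om) else h (x t.+1 om) - h (x t om).

Hypothesis n_gt0 : (0 < n)%N.
Hypothesis a1_gt0 : (0 < a1)%N.
Hypothesis a2_gt0 : (0 < a2)%N.
Hypothesis Kx : forall om, K (x t om).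
Hypothesis KxS : forall om, K (x t.+1 om).
Hypothesis mx : forall i, measurable_fun setT (fun om : known F A0 => x t om 0 i).
Hypothesis mxS : forall i, measurable_fun setT (fun om : known F A0 => x t.+1 om 0 i).
Hypothesis mgbar : forall i, bmeas (fun om : known F A0 => gbar t om 0 i).

Let sgrad (zeta : Z) (y : 'rV[R]_d) := grad (ft ^~ zeta) y.

Lemma increment_mx (h : 'rV[R]_d -> 'rV[R]_d) om i :
  increment h om 0 i = increment (fun y => h y 0 i) om.
Proof. by rewrite /increment; case: ifP => _; rewrite ?mxE. Qed.

Lemma sgrad_at_bmeas i (y : Omega -> 'rV[R]_d) :
  (forall om, K (y om)) ->
  (forall i, measurable_fun setT (fun om : known F A0 => y om 0 i)) ->
  bmeas (fun q : known F A0 * Z => sgrad q.2 (y q.1) 0 i).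
Proof.
move=> Ky my; split.
  apply: (@lipschitz_joint_measurable _ _ _ (known F A0) Z d K
    (L * Num.sqrt d%:R) y (fun y zeta => sgrad zeta y 0 i)) => //.
    by move=> y1 y2 zeta; exact: sample_grad_lipschitz.
  by move=> y' Ky'; have [] := sample_grad_bmeas grad_unbiased grad_bounded i Ky'.
exists Ginf => q; apply: le_trans (coord_le_norm _ _) _; exact: grad_bounded.
Qed.

Lemma fgrad_at_bmeas i (y : Omega -> 'rV[R]_d) :
  (forall om, K (y om)) ->
  (forall i, measurable_fun setT (fun om : known F A0 => y om 0 i)) ->
  bmeas (fun om : known F A0 => grad f (y om) 0 i).
Proof.
move=> Ky my; split; last first.
  exists Ginf => q; exact: (objective_grad_le grad_unbiased grad_bounded).
have H := @lipschitz_joint_measurable _ _ _ (known F A0) unit d K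
    (L * Num.sqrt d%:R) y (fun y _ => grad f y 0 i) Ky my.
have mp : measurable_fun setT (fun om : known F A0 => (om, tt)).
  by apply: measurable_fun_pair => //; exact: measurable_cst.
apply: (measurableT_comp (H _ _) mp).
- move=> y1 y2 _; exact: (objective_grad_lipschitz L_gt0 ft_smooth f_diff
    grad_unbiased grad_bounded).
- by move=> y' _; exact: measurable_cst.
Qed.

Lemma sincr_bmeas i : bmeas (fun q : known F A0 * Z => increment (sgrad q.2) q.1 0 i).
Proof.
under eq_fun do rewrite increment_mx.
rewrite /increment; case: st; first exact: sgrad_at_bmeas.
by apply: bmeasB; apply: sgrad_at_bmeas.
Qed.

Lemma fincr_bmeas i : bmeas (fun om : known F A0 => increment (grad f) om 0 i).
Proof.
under eq_fun do rewrite increment_mx.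
rewrite /increment; case: st; first exact: fgrad_at_bmeas.
by apply: bmeasB; apply: fgrad_at_bmeas.
Qed.

Definition sampling_error i (q : known F A0 * Z) : R :=
  increment (sgrad q.2) q.1 0 i - increment (grad f) q.1 0 i.

Lemma sampling_error_bmeas i : bmeas (sampling_error i).
Proof.
apply: bmeasB; first exact: sincr_bmeas.
exact: (bmeas_comp measurable_fst (fincr_bmeas i)).
Qed.

Lemma sampling_error_mean i om : \int[P]_zeta sampling_error i (om, zeta) = 0.
Proof.
have bs y : K y -> bmeas (fun zeta => sgrad zeta y 0 i).
  exact: (sample_grad_bmeas grad_unbiased grad_bounded i).
have ms y : K y -> \int[P]_zeta sgrad zeta y 0 i = grad f y 0 i.
  exact: (sample_grad_mean grad_unbiased i).
under eq_Rintegral do rewrite /sampling_error !increment_mx.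
rewrite /increment /=; case: st.
  rewrite mean_sub ?mean_cst ?ms ?subrr//; try exact: bmeas_cst; exact: bs.
rewrite !mean_sub ?mean_cst ?ms ?subrr//; try apply: bmeasB; try exact: bmeas_cst;
  exact: bs.
Qed.


Definition wgrad m om : 'rV[R]_d :=
  n%:R^-1 *: \sum_(j < n) increment (sgrad (z t.+1 m j om)) om.

Lemma worker_gradE m om :
  worker_grad ft p S eta x1 (fun t' m j => z t' m j om) (fun t' => v t' om) t.+1 m
  = wgrad m om.
Proof.
have gm y : K y -> grad (batch_mean ft p S (fun t' m j => z t' m j om) t.+1 m) y =
    n%:R^-1 *: \sum_(j < n) sgrad (z t.+1 m j om) y.
  by move=> Ky; apply: grad_mean => j; exact: ((ft_smooth _).1 _ Ky).
rewrite /worker_grad /wgrad /increment -/st; case: st; first exact: gm (KxS om).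
by rewrite sumrB scalerBr (gm _ (KxS om)) (gm _ (Kx om)).
Qed.

Lemma fresh_at_bmeas (A : set (source M d)) d' (T : measurableType d')
    (xi : {RV Pr >-> T}) (phi : known F A * T -> R) :
  bmeas phi -> bmeas (fun om : Omega => phi (om, xi om)).
Proof.
move=> bphi; apply: (@bmeas_comp _ _ _ _ _
  (fun om : Omega => (om : known F A, xi om)) phi _ bphi).
exact: freeze_measurable.
Qed.

Let A0_fresh m j : ~ A0 (Sample d t.+1 m j).
Proof. by rewrite /A0 /upto /= ltnn. Qed.

Lemma sampling_variance_start m j : st ->
  \sum_(i < d) \int[Pr]_om (sampling_error i (om, z t.+1 m j om)) ^+ 2
    <= sigma ^+ 2.
Proof.
move=> st1; rewrite -mean_sum; last first.
  by move=> i; apply: bmeasX; exact: fresh_at_bmeas (sampling_error_bmeas i).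
have bphi : bmeas (fun q : known F A0 * Z => \sum_(i < d) sampling_error i q ^+ 2).
  by apply: bmeas_sum => i; apply: bmeasX; exact: sampling_error_bmeas.
apply: (@freeze_le _ _ _ Pr _ F FT FI Fm F_independent A0 (Sample d t.+1 m j)
  (@A0_fresh m j) _ _ (z t.+1 m j) P erefl (@z_law _ _ _)
  (fun q => \sum_(i < d) sampling_error i q ^+ 2)) => //.
move=> om; have bphi_om := bmeas_comp (pair1_measurable (om : known F A0)) bphi.
rewrite -lee_fin fineK; last first.
  exact: (integrable_fin_num measurableT (bmeas_integrable P bphi_om)).
have := grad_variance (KxS om); rewrite unlock; apply: le_trans.
rewrite le_eqVlt; apply/orP; left; apply/eqP; apply: eq_integral => zeta _.
congr EFin; rewrite enorm_sqr_sum; apply: eq_bigr => i _.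
rewrite /sampling_error !increment_mx /increment st1 [X in _ = X ^+ 2]mxE.
by congr ((_ + _) ^+ 2); rewrite [RHS]mxE.
Qed.

(** The sampling error and the true increment are orthogonal and add up to the
    sampled increment, so the variance is at most the second moment of the latter,
    which is small because consecutive iterates are close. *)
Lemma sampling_variance_increment (c : R) m j :
  (forall zeta om, enorm (increment (sgrad zeta) om) <= c) ->
  \sum_(i < d) \int[Pr]_om (sampling_error i (om, z t.+1 m j om)) ^+ 2
    <= c ^+ 2.
Proof.
move=> incr_le.
have bs i : bmeas (fun om : Omega => increment (sgrad (z t.+1 m j om)) om 0 i).
  exact: (fresh_at_bmeas _ (sincr_bmeas i)).
apply: (@le_trans _ _ (\sum_(i < d)
    \int[Pr]_om (increment (sgrad (z t.+1 m j om)) om 0 i) ^+ 2)).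
  apply: ler_sum => i _.
  have := @fresh_one A0 _ (@A0_fresh m j) _ _ (z t.+1 m j) P erefl (@z_law _ _ _)
    (fun om => increment (grad f) om 0 i) (sampling_error i) (fincr_bmeas i)
    (sampling_error_bmeas i) (sampling_error_mean i).
  under eq_Rintegral do rewrite /sampling_error /= addrC subrK.
  move=> ->; rewrite lerDr; apply: Rintegral_ge0 => om _; exact: sqr_ge0.
rewrite -mean_sum; last by move=> i; exact: bmeasX.
rewrite -[leRHS](mean_cst Pr); apply: mean_mono.
- by apply: bmeas_sum => i; exact: bmeasX.
- exact: bmeas_cst.
- move=> om; rewrite -enorm_sqr_sum lerXn2r// ?nnegrE ?enorm_ge0//.
  exact: le_trans (enorm_ge0 _) (incr_le point om).
Qed.

Variable delta : R.
Hypothesis increment_le : forall zeta om, `|increment (sgrad zeta) om| <= delta.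

Lemma delta_ge0 : 0 <= delta.
Proof. exact: le_trans (normr_ge0 _) (increment_le point point). Qed.

Lemma average_le (k : nat) (a : 'I_k -> R) (c : R) : (0 < k)%N ->
  (forall j, `|a j| <= c) -> `|k%:R^-1 * \sum_(j < k) a j| <= c.
Proof.
move=> k0 ac; rewrite normrM ger0_norm ?invr_ge0// mulrC ler_pdivrMr ?ltr0n//.
apply: le_trans (ler_norm_sum _ _ _) _.
apply: (@le_trans _ _ (\sum_(j < k) c)); first exact: ler_sum.
by rewrite sumr_const card_ord -[leLHS]mulr_natr.
Qed.

Lemma wgradE m om i :
  wgrad m om 0 i = n%:R^-1 * \sum_(j < n) increment (sgrad (z t.+1 m j om)) om 0 i.
Proof. by rewrite /wgrad mxE summxE. Qed.

Lemma wgrad_le m om : `|wgrad m om| <= delta.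
Proof.
apply: norm_le_coord => [|i]; first exact: delta_ge0.
rewrite wgradE; apply: average_le => // j.
exact: le_trans (coord_le_norm _ _) (increment_le _ _).
Qed.

Let A1 := after_samples.
Let A2 := after_workers.

Lemma wgrad_bmeas m i : bmeas (fun om : known F A1 => wgrad m om 0 i).
Proof.
under eq_fun do rewrite wgradE.
apply: bmeasZ; apply: bmeas_sum => j.
apply: (fresh_known (b := Sample d t.+1 m j) _ _ erefl (sincr_bmeas i)).
  exact: subsetUl.
by right; exists m, j.
Qed.

Lemma wgrad_norm_measurable m : measurable_fun setT (fun om : known F A1 => `|wgrad m om|).
Proof. by apply: norm_measurable => i; have [] := wgrad_bmeas m i. Qed.

Definition worker_error m i (q : known F A1 * R) : R :=
  M%:R^-1 * (decode_coord a1 `|wgrad m q.1| (wgrad m q.1 0 i) q.2 - wgrad m q.1 0 i).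

Lemma worker_decode_bmeas m i : bmeas (fun q : known F A1 * R =>
  decode_coord a1 `|wgrad m q.1| (wgrad m q.1 0 i) q.2).
Proof.
split; last first.
  exists delta => q; apply: le_trans (wgrad_le m q.1).
  by apply: decode_coord_le => //; exact: coord_le_norm.
apply: decode_coord_measurable.
- by move=> q; exact: coord_le_norm.
- exact: (measurableT_comp (wgrad_norm_measurable m) measurable_fst).
- by have [mw _] := wgrad_bmeas m i; exact: (measurableT_comp mw measurable_fst).
- exact: measurable_snd.
Qed.

Lemma worker_error_bmeas m i : bmeas (worker_error m i).
Proof.
apply: bmeasZ; apply: bmeasB; first exact: worker_decode_bmeas.
exact: (bmeas_comp measurable_fst (wgrad_bmeas m i)).
Qed.

Lemma worker_error_mean m i om :
  \int[unit_uniform]_r worker_error m i (om, r) = 0.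
Proof.
rewrite /worker_error /= mean_scale ?decode_coord_unbiased ?mulr0//.
  exact: coord_le_norm.
apply: bmeasB; last exact: bmeas_cst.
exact: (bmeas_comp (pair1_measurable (om : known F A1)) (worker_decode_bmeas m i)).
Qed.

Definition mavg om : 'rV[R]_d :=
  master_avg ft p S s1 eta x1 (fun t' m j => z t' m j om)
    (fun t' m i => u t' m i om) (fun t' => v t' om) t.+1.

Lemma mavgE om i : mavg om 0 i = M%:R^-1 *
  \sum_(m < M) decode_coord a1 `|wgrad m om| (wgrad m om 0 i) (u t.+1 m i om).
Proof.
rewrite /mavg /master_avg mxE summxE; congr (_ * _); apply: eq_bigr => m _.
by rewrite mxE worker_gradE.
Qed.

Lemma mavg_le om : `|mavg om| <= delta.
Proof.
apply: norm_le_coord => [|i]; first exact: delta_ge0.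
rewrite mavgE; apply: average_le => // m; apply: le_trans (wgrad_le m om).
by apply: decode_coord_le => //; exact: coord_le_norm.
Qed.

Lemma mavg_bmeas i : bmeas (fun om : known F A2 => mavg om 0 i).
Proof.
under eq_fun do rewrite mavgE.
apply: bmeasZ; apply: bmeas_sum => m.
apply: (fresh_known (b := WorkerDraw t.+1 m i) _ _ erefl (worker_decode_bmeas m i)).
  exact: subsetUl.
by right; exists m, i.
Qed.

Definition master_error i (q : known F A2 * R) : R :=
  decode_coord a2 `|mavg q.1| (mavg q.1 0 i) q.2 - mavg q.1 0 i.

Lemma master_decode_bmeas i : bmeas (fun q : known F A2 * R =>
  decode_coord a2 `|mavg q.1| (mavg q.1 0 i) q.2).
Proof.
split; last first.
  exists delta => q; apply: le_trans (mavg_le q.1).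
  by apply: decode_coord_le => //; exact: coord_le_norm.
have mm : measurable_fun setT (fun om : known F A2 => `|mavg om|).
  by apply: norm_measurable => k; have [] := mavg_bmeas k.
apply: decode_coord_measurable.
- by move=> q; exact: coord_le_norm.
- exact: (measurableT_comp mm measurable_fst).
- by have [mw _] := mavg_bmeas i; exact: (measurableT_comp mw measurable_fst).
- exact: measurable_snd.
Qed.

Lemma master_error_bmeas i : bmeas (master_error i).
Proof.
apply: bmeasB; first exact: master_decode_bmeas.
exact: (bmeas_comp measurable_fst (mavg_bmeas i)).
Qed.

Lemma master_error_mean i om :
  \int[unit_uniform]_r master_error i (om, r) = 0.
Proof.
by rewrite /master_error /= decode_coord_unbiased//; exact: coord_le_norm.
Qed.

(** The error carried over from the previous round; a new period forgets it. *)
Definition previous_error om : 'rV[R]_d :=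
  if st then 0 else gbar t om - grad f (x t om).

Lemma gbarE om i : gbar t.+1 om 0 i =
  decode_coord a2 `|mavg om| (mavg om 0 i) (w t.+1 i om) +
  (if st then 0 else gbar t om 0 i).
Proof.
rewrite /gbar /grad_est -/grad_est -/st /master_decode.
case: st; first by rewrite addr0 mxE.
by rewrite [LHS]mxE; congr (_ + _); rewrite mxE.
Qed.

Lemma gbar_bmeas i : bmeas (fun om : known F (upto t.+1) => gbar t.+1 om 0 i).
Proof.
under eq_fun do rewrite gbarE.
apply: bmeasD.
  apply: (fresh_known (b := MasterDraw M t.+1 i) _ _ erefl (master_decode_bmeas i)).
    move=> a [[|]|] /=; first by move/leqW.
      by move=> [m [j ->]]; exact: leqnn.
    by move=> [m [j ->]]; exact: leqnn.
  exact: leqnn.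
case: st; first exact: bmeas_cst.
by apply: known_mono (mgbar i) => a /=; exact: leqW.
Qed.

(** Telescoping through the average of the workers' gradients and through the
    average of their decoded gradients. *)
Lemma error_decomposition om i :
  (gbar t.+1 om - grad f (x t.+1 om)) 0 i =
  previous_error om 0 i
  + \sum_(mj : 'I_M * 'I_n) (M%:R * n%:R)^-1 *
      sampling_error i (om, z t.+1 mj.1 mj.2 om)
  + \sum_(m < M) worker_error m i (om, u t.+1 m i om)
  + master_error i (om, w t.+1 i om).
Proof.
have M0 : M%:R != 0 :> R by rewrite pnatr_eq0 -lt0n.
have n0 : n%:R != 0 :> R by rewrite pnatr_eq0 -lt0n.
rewrite [LHS]mxE gbarE [X in _ + X]mxE /master_error /=.
have -> : \sum_(m < M) worker_error m i (om, u t.+1 m i om) =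
    mavg om 0 i - M%:R^-1 * \sum_(m < M) wgrad m om 0 i.
  by rewrite mavgE -mulrBr -sumrB mulr_sumr.
have -> : \sum_(mj : 'I_M * 'I_n) (M%:R * n%:R)^-1 *
      sampling_error i (om, z t.+1 mj.1 mj.2 om) =
    M%:R^-1 * \sum_(m < M) wgrad m om 0 i - increment (grad f) om 0 i.
  rewrite -(pair_bigA _ (fun (m : 'I_M) (j : 'I_n) => (M%:R * n%:R)^-1 *
      sampling_error i (om, z t.+1 m j om))) /=.
  transitivity (\sum_(m < M) M%:R^-1 * (wgrad m om 0 i - increment (grad f) om 0 i)).
    apply: eq_bigr => m _; rewrite -mulr_sumr /sampling_error /= sumrB sumr_const card_ord wgradE.
    by rewrite -[X in _ * (_ - X) = _]mulr_natl; field; rewrite M0 n0.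
  rewrite -mulr_sumr sumrB sumr_const card_ord -[X in _ * (_ - X) = _]mulr_natl mulrBr.
  by rewrite mulKf.
rewrite increment_mx /previous_error /increment; case: st; rewrite !mxE; ring.
Qed.

Lemma previous_error_bmeas i :
  bmeas (fun om : known F A0 => previous_error om 0 i).
Proof.
rewrite /previous_error; case: st.
  by under eq_fun do rewrite mxE; exact: bmeas_cst.
have E om : (gbar t om - grad f (x t om)) 0 i = gbar t om 0 i - grad f (x t om) 0 i.
  by rewrite mxE [X in _ + X]mxE.
under eq_fun do rewrite E; apply: bmeasB; [exact: mgbar|exact: fgrad_at_bmeas].
Qed.

Let sampled i (mj : 'I_M * 'I_n) (q : known F A0 * Z) : R :=
  (M%:R * n%:R)^-1 * sampling_error i q.

(** The noises are split off backwards in time, the master's first and the samples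
    last, so that what remains is always known when the next one is drawn. *)
Lemma coordinate_pythagoras i :
  \int[Pr]_om ((gbar t.+1 om - grad f (x t.+1 om)) 0 i) ^+ 2 =
  \int[Pr]_om (previous_error om 0 i) ^+ 2
  + \sum_(mj : 'I_M * 'I_n) \int[Pr]_om
      (sampled i mj (om, z t.+1 mj.1 mj.2 om)) ^+ 2
  + \sum_(m < M) \int[Pr]_om (worker_error m i (om, u t.+1 m i om)) ^+ 2
  + \int[Pr]_om (master_error i (om, w t.+1 i om)) ^+ 2.
Proof.
have bsampled mj : bmeas (sampled i mj) by apply: bmeasZ; exact: sampling_error_bmeas.
pose W1 om := previous_error om 0 i
  + \sum_(mj : 'I_M * 'I_n) sampled i mj (om, z t.+1 mj.1 mj.2 om).
pose W2 om := W1 om + \sum_(m < M) worker_error m i (om, u t.+1 m i om).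
have A01 : A0 `<=` A1 by exact: subsetUl.
have A12 : A1 `<=` A2 by exact: subsetUl.
have bW1 : bmeas (fun om : known F A1 => W1 om).
  apply: bmeasD; first exact: known_mono A01 (previous_error_bmeas i).
  apply: bmeas_sum => -[m j].
  apply: (fresh_known (b := Sample d t.+1 m j) A01 _ erefl (bsampled (m, j))).
  by right; exists m, j.
have bW2 : bmeas (fun om : known F A2 => W2 om).
  apply: bmeasD; first exact: known_mono A12 bW1.
  apply: bmeas_sum => m.
  apply: (fresh_known (b := WorkerDraw t.+1 m i) A12 _ erefl (worker_error_bmeas m i)).
  by right; exists m, i.
under eq_Rintegral do rewrite error_decomposition.
transitivity (\int[Pr]_om (W2 om) ^+ 2 +
    \int[Pr]_om (master_error i (om, w t.+1 i om)) ^+ 2).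
  apply: (@fresh_one A2 (MasterDraw M t.+1 i) _ _ _ (w t.+1 i)
    (@unit_uniform R) erefl _ W2 (master_error i)) => //.
  - by move=> [[|[m [j]]]|[m [j]]] //; rewrite /A0 /upto /= ltnn.
  - exact: w_law.
  - exact: master_error_bmeas.
  - exact: master_error_mean.
congr (_ + _).
transitivity (\int[Pr]_om (W1 om) ^+ 2 +
    \sum_(m < M) \int[Pr]_om (worker_error m i (om, u t.+1 m i om)) ^+ 2).
  apply: (@fresh_sum _ _ _ _ A1 (fun m => WorkerDraw t.+1 m i)
    (fun m => u t.+1 m i) (@unit_uniform R) W1
    (fun m => worker_error m i)) => //.
  - exact: index_enum_uniq.
  - by move=> m m' [].
  - by move=> m [|[m' [j]]] //; rewrite /A0 /upto /= ltnn.
  - by move=> m B; exact: u_law.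
  - by move=> m; exact: worker_error_bmeas.
  - by move=> m om; exact: worker_error_mean.
congr (_ + _).
apply: (@fresh_sum _ _ _ _ A0 (fun mj : 'I_M * 'I_n => Sample d t.+1 mj.1 mj.2)
  (fun mj => z t.+1 mj.1 mj.2) P (fun om => previous_error om 0 i)
  (sampled i)) => //.
- exact: index_enum_uniq.
- by move=> [m j] [m' j'] [-> /ord_inj ->].
- by move=> mj B; exact: z_law.
- exact: previous_error_bmeas.
- move=> mj om; rewrite /sampled /= mean_scale ?sampling_error_mean ?mulr0//.
  exact: (bmeas_comp (pair1_measurable (om : known F A0)) (sampling_error_bmeas i)).
Qed.

Lemma bounded_second_moment (X : Omega -> R) (c : R) : bmeas X ->
  (forall om, `|X om| <= c) -> \int[Pr]_om (X om) ^+ 2 <= c ^+ 2.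
Proof.
move=> bX Xc; rewrite -[leRHS](mean_cst Pr).
apply: mean_mono => [||om]; [exact: bmeasX|exact: bmeas_cst|].
by rewrite -(real_normK (num_real (X om))) lerXn2r// ?nnegrE// (le_trans _ (Xc om)).
Qed.

Variable V : R.
Hypothesis sampling_variance : forall m j, \sum_(i < d) \int[Pr]_om
  (sampling_error i (om, z t.+1 m j om)) ^+ 2 <= V.

(** Averaging over [M] independent workers divides the sampling and the worker
    encoding terms by [M]; the single encoding of the master gains nothing from
    it, hence its finer levels. *)
Lemma round_error :
  \sum_(i < d) \int[Pr]_om ((gbar t.+1 om - grad f (x t.+1 om)) 0 i) ^+ 2 <=
  \sum_(i < d) \int[Pr]_om (previous_error om 0 i) ^+ 2
  + V / (M%:R * n%:R) + d%:R * delta ^+ 2 / (M%:R * a1%:R ^+ 2)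
  + d%:R * delta ^+ 2 / a2%:R ^+ 2.
Proof.
have M0 : M%:R != 0 :> R by rewrite pnatr_eq0 -lt0n.
have n0 : n%:R != 0 :> R by rewrite pnatr_eq0 -lt0n.
have a10 : a1%:R != 0 :> R by rewrite pnatr_eq0 -lt0n.
have a20 : a2%:R != 0 :> R by rewrite pnatr_eq0 -lt0n.
under eq_bigr do rewrite coordinate_pythagoras.
rewrite !big_split /= -!addrA lerD2l; apply: lerD; last apply: lerD.
- rewrite exchange_big /=.
  have -> : V / (M%:R * n%:R) =
      \sum_(mj : 'I_M * 'I_n) ((M%:R * n%:R)^-1) ^+ 2 * V.
    rewrite sumr_const card_prod !card_ord -[RHS]mulr_natl natrM.
    by field; rewrite M0 n0.
  apply: ler_sum => -[m j] _ /=.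
  apply: le_trans (ler_wpM2l (sqr_ge0 _) (sampling_variance m j)).
  rewrite mulr_sumr; apply: ler_sum => i _; rewrite /sampled /=.
  under eq_Rintegral do rewrite exprMn.
  by rewrite mean_scale//; apply: bmeasX; exact: fresh_at_bmeas (sampling_error_bmeas i).
- have -> : d%:R * delta ^+ 2 / (M%:R * a1%:R ^+ 2) =
      \sum_(i < d) \sum_(m < M) (M%:R^-1 * (delta / a1%:R)) ^+ 2.
    under eq_bigr do rewrite sumr_const card_ord -mulr_natl.
    by rewrite sumr_const card_ord -[RHS]mulr_natl; field; rewrite M0 a10.
  apply: ler_sum => i _; apply: ler_sum => m _; apply: bounded_second_moment.
    exact: fresh_at_bmeas (worker_error_bmeas m i).
  move=> om; rewrite /worker_error /= normrM ger0_norm ?invr_ge0//.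
  rewrite ler_wpM2l ?invr_ge0//.
  apply: le_trans (decode_coord_near _ a1_gt0 (coord_le_norm _ _)) _.
  by rewrite ler_wpM2r ?invr_ge0// wgrad_le.
- have -> : d%:R * delta ^+ 2 / a2%:R ^+ 2 = \sum_(i < d) (delta / a2%:R) ^+ 2.
    by rewrite sumr_const card_ord -[RHS]mulr_natl; field; rewrite a20.
  apply: ler_sum => i _; apply: bounded_second_moment.
    exact: fresh_at_bmeas (master_error_bmeas i).
  move=> om; rewrite /master_error /=.
  apply: le_trans (decode_coord_near _ a2_gt0 (coord_le_norm _ _)) _.
  by rewrite ler_wpM2r ?invr_ge0// mavg_le.
Qed.

End OneRound.
End Rounds.

(** * Schedules and the Frank-Wolfe step *)

Section Schedules.
Context {R : realType}.

Lemma doubling_sum i : (\sum_(1 <= j < i.+1) 2 ^ j.-1 = (2 ^ i).-1)%N.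
Proof.
elim: i => [|i IH]; first by rewrite big_geq.
by rewrite big_nat_recr//= IH expnS; have := expn_gt0 2 i; lia.
Qed.

(** With periods of lengths 1, 2, 4, ..., the [i]-th one starts at round [2 ^ i.-1],
    its own length. Hence the step size [2 / (p_i + k)] is the classical
    [2 / (t + 1)], and [p_i] is at least [(t + 1) / 2]. *)
Lemma doubling_pos t i k : (0 < t)%N ->
  period_pos (fun i => 2 ^ i.-1)%N t = (i, k) ->
  [/\ (0 < k)%N, (k <= 2 ^ i.-1)%N & (2 ^ i.-1 + k = t.+1)%N].
Proof.
move=> t0 E; have := @period_posP (fun i => 2 ^ i.-1)%N t.
rewrite E => /(_ (fun _ => _) t0)[|i0 /andP[k0 ki] ->]; first by move=> j; rewrite expn_gt0.
split=> //; case: i i0 {E ki} => // i _; rewrite doubling_sum /=.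
by have := expn_gt0 2 i; lia.
Qed.

Lemma nceil_ge (a : R) : 0 <= a -> a <= (nceil a)%:R.
Proof.
move=> a0; rewrite /nceil natr_absz ger0_norm; first exact: ceil_ge.
by rewrite ceil_ge0 (lt_le_trans _ a0)// ltrN10.
Qed.

Lemma nceil_gt0 (a : R) : 0 < a -> (0 < nceil a)%N.
Proof.
by move=> a0; rewrite -(ltr0n R) (lt_le_trans a0)// nceil_ge// ltW.
Qed.

Lemma nceil_sqrt_ge (a : R) : 0 <= a -> a <= (nceil (Num.sqrt a))%:R ^+ 2.
Proof.
move=> a0; rewrite -{1}(sqr_sqrtr a0) lerXn2r ?nnegrE ?sqrtr_ge0//.
exact/nceil_ge/sqrtr_ge0.
Qed.

(** The weights [t (t - 1)] make the recursion telescope. *)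
Lemma weighted_recursion (h : nat -> R) (B : R) (T : nat) : 0 <= B ->
  (forall t, (0 < t <= T)%N ->
    t%:R * t.+1%:R * h t.+1 <= t.-1%:R * t%:R * h t + B) ->
  (0 < T)%N -> h T.+1 <= B / T%:R.
Proof.
move=> B0 rec T0.
have sum t : (t <= T)%N -> t%:R * t.+1%:R * h t.+1 <= t%:R * B.
  elim: t => [|t IH] tT; first by rewrite !mul0r.
  apply: le_trans (rec t.+1 tT) _; rewrite -[in leRHS]natr1 mulrDl mul1r lerD2r.
  exact: IH (ltnW tT).
have Tp : 0 < T%:R :> R by rewrite ltr0n.
have := sum T (leqnn T); rewrite -mulrA ler_pM2l// -natr1 mulrDl mul1r => h1.
rewrite ler_pdivlMr// mulrC.
have [h0|h0] := leP 0 (h T.+1); first by lra.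
by apply: le_trans B0; rewrite pmulr_rle0// ltW.
Qed.

End Schedules.

Section FrankWolfe.
Context {R : realType} {d : nat}.
Variables (K : set 'rV[R]_d) (L : R) (f : 'rV[R]_d -> R).
Hypothesis K_convex : convex_set K.
Hypothesis K_compact : compact K.
Hypothesis f_convex : convex_function K f.
Hypothesis f_smooth : smooth_on K L f.
Hypothesis L_ge0 : 0 <= L.
Let D := diameter K.

(** The vertex [v] minimizes the linear form given by the estimate [g], so using it
    in place of [y] costs at most the estimation error times the diameter. The
    error enters squared, by the arithmetic-geometric inequality with a free
    weight [c], so that only its second moment has to be controlled. *)
Lemma frank_wolfe_step (x y v g : 'rV[R]_d) (eta c : R) :
  K x -> K y -> is_argmin K (fun y => dot y g) v -> 0 <= eta <= 1 -> 0 < c ->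
  f (x + eta *: (v - x)) - f y <= (1 - eta) * (f x - f y)
    + eta * D * (c^-1 * enorm (g - grad f x) ^+ 2 + c) / 2
    + L * eta ^+ 2 * D ^+ 2 / 2.
Proof.
move=> Kx Ky [Kv vmin] /andP[e0 e1] c0.
have Kn := convex_line K_convex Kx Kv e0 e1.
have h1 := descent K_convex f_smooth Kx Kn.
have h2 := convex_gradient K_convex f_convex Kx Ky (f_smooth.1 _ Kx).
have h3 := vmin _ Ky.
have D0 : 0 <= D by apply: le_trans (enorm_ge0 _) (diameter_ge K_compact Kx Ky).
set N := enorm (g - grad f x).
have N0 : 0 <= N by exact: enorm_ge0.
have h4 : dot (g - grad f x) (y - v) <= N * D.
  apply: le_trans (cauchy_schwarz _ _) _; rewrite ler_wpM2l//.
  exact: diameter_ge.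
have h5 : N <= (c^-1 * N ^+ 2 + c) / 2.
  rewrite -(ler_pM2l c0); have -> : c * ((c^-1 * N ^+ 2 + c) / 2) = (N ^+ 2 + c ^+ 2) / 2.
    by field; rewrite gt_eqF.
  by have := sqr_ge0 (N - c); rewrite sqrrB; lra.
have h6 : enorm (eta *: (v - x)) ^+ 2 <= eta ^+ 2 * D ^+ 2.
  rewrite enormZ exprMn real_normK ?num_real// ler_wpM2l ?sqr_ge0//.
  by rewrite lerXn2r ?nnegrE ?enorm_ge0//; exact: diameter_ge.
have h7 : dot (grad f x) (v - x) <= f y - f x + N * D.
  move: h2 h3 h4; rewrite !(dotBl, dotBr) (dotC v) (dotC y); lra.
have h8 : eta * dot (grad f x) (v - x) <=
    eta * (f y - f x + (c^-1 * N ^+ 2 + c) / 2 * D).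
  rewrite ler_wpM2l//; apply: le_trans h7 _; rewrite lerD2l ler_wpM2r//.
have h9 : L / 2 * enorm (eta *: (v - x)) ^+ 2 <= L / 2 * (eta ^+ 2 * D ^+ 2).
  by rewrite ler_wpM2l// divr_ge0.
move: h1; rewrite [x + _ - x]addrC addKr dotZr => h1.
lra.
Qed.

End FrankWolfe.


(** * The convergence rate *)

Section Rate.
Context {R : realType} {d q M T : nat}.
Variables (K : set 'rV[R]_d) (L sigma Ginf : R).
Variables (P : probability (q.-tuple R) R) (ft : 'rV[R]_d -> q.-tuple R -> R).
Variables (x1 xstar : 'rV[R]_d).
Context {dO : measure_display} {Omega : measurableType dO}.
Variables (Pr : probability Omega R).
Variables (z : nat -> 'I_M -> nat -> {RV Pr >-> q.-tuple R}).
Variables (u : nat -> 'I_M -> 'I_d -> {RV Pr >-> R}).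
Variables (w : nat -> 'I_d -> {RV Pr >-> R}).
Variables (v : nat -> Omega -> 'rV[R]_d).
Let f := fun x : 'rV[R]_d => fine ('E_P[ft x])%E.
Let D := diameter K.
Let p := fun i : nat => (2 ^ i.-1)%N.
Let S := fun i k : nat =>
    if k == 1%N
    then maxn 1 (nceil (sigma ^+ 2 * (p i)%:R ^+ 2
                        / (M%:R * L ^+ 2 * D ^+ 2)))
    else nceil ((p i)%:R / M%:R : R).
Let s1 := fun i k : nat =>
    if k == 1%N then nceil (Num.sqrt (d%:R * (p i)%:R ^+ 2 / M%:R : R))
    else nceil (Num.sqrt (d%:R * (p i)%:R / M%:R : R)).
Let s2 := fun i k : nat =>
    if k == 1%N then nceil (Num.sqrt (d%:R * (p i)%:R ^+ 2 : R))
    else nceil (Num.sqrt (d%:R * (p i)%:R : R)).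
Let eta := fun i k : nat => 2 / ((p i)%:R + k%:R) : R.
Let F := source_sigma z u w.
Let x := fun (t : nat) (om : Omega) =>
    qfw_x p eta x1 (fun t' => v t' om) t.
Let gbar := fun (t : nat) (om : Omega) =>
    grad_est ft p S s1 s2 eta x1
      (fun t' m j => z t' m j om) (fun t' m i => u t' m i om)
      (fun t' i => w t' i om) (fun t' => v t' om) t.

Hypothesis M_gt0 : (0 < M)%N.
Hypothesis L_gt0 : 0 < L.
Hypothesis K_convex : convex_set K.
Hypothesis K_compact : compact K.
Hypothesis ft_convex : forall zeta, convex_function K (ft ^~ zeta).
Hypothesis ft_smooth : forall zeta, smooth_on K L (ft ^~ zeta).
Hypothesis ft_integrable : forall y, K y -> P.-integrable setT (EFin \o ft y).
Hypothesis f_diff : forall y, K y -> differentiable f y.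
Hypothesis grad_unbiased : forall y i, K y ->
  P.-integrable setT (fun zeta => (grad (ft ^~ zeta) y 0 i)%:E) /\
  ('E_P[fun zeta => (grad (ft ^~ zeta) y 0 i)%R] = (grad f y 0 i)%R%:E)%E.
Hypothesis grad_variance : forall y, K y ->
  ('E_P[fun zeta => (enorm (grad (ft ^~ zeta) y - grad f y) ^+ 2)%R]
    <= (sigma ^+ 2)%:E)%E.
Hypothesis grad_bounded : forall y zeta, K y -> `|grad (ft ^~ zeta) y| <= Ginf.
Hypothesis Kx1 : K x1.
Hypothesis xstar_min : is_argmin K f xstar.
Hypothesis z_law : forall t m j (B : set (q.-tuple R)), measurable B ->
  distribution Pr (z t m j) B = P B.
Hypothesis u_law : forall t m i (B : set R), measurable B ->
  distribution Pr (u t m i) B = uniform_prob (@ltr01 R) B.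
Hypothesis w_law : forall t i (B : set R), measurable B ->
  distribution Pr (w t i) B = uniform_prob (@ltr01 R) B.
Hypothesis F_independent : mutually_independent Pr F.
Hypothesis v_argmin : forall t om, (0 < t <= T)%N ->
    is_argmin K (fun y => dot y (gbar t om)) (v t om).
Hypothesis v_measurable : forall t, (0 < t <= T)%N ->
  history_measurable (history F t) (v t).

Lemma period_posE t : (0 < t)%N -> exists i k,
  [/\ period_pos p t = (i, k), (0 < k)%N, (k <= p i)%N & (p i + k = t.+1)%N].
Proof.
case E : (period_pos p t) => [i k] t0; exists i, k.
by have [k0 ki e] := doubling_pos t0 E; split.
Qed.

Lemma eta_at t : (0 < t)%N -> at_round p eta t = 2 / t.+1%:R.
Proof.
move=> t0; have [i [k [E _ _ e]]] := period_posE t0.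
by rewrite /at_round E /eta -natrD e.
Qed.

Lemma xS t om : x t.+2 om = x t.+1 om + (2 / t.+2%:R) *: (v t.+1 om - x t.+1 om).
Proof. by rewrite -eta_at. Qed.

Lemma eta01 t : 0 <= (2 / t.+2%:R : R) <= 1.
Proof. by rewrite divr_ge0//= ler_pdivrMr ?ltr0n// mul1r ler_nat. Qed.

Lemma x_in_K t om : (t <= T)%N -> K (x t.+1 om).
Proof.
elim: t => [//|t IH] tT; rewrite xS.
have /andP[e0 e1] := eta01 t.
apply: convex_line => //; first exact/IH/ltnW.
by have [] := v_argmin om (t := t.+1) tT.
Qed.

Lemma x_known t i : (t <= T)%N ->
  measurable_fun setT (fun om : known F (upto t) => x t.+1 om 0 i).
Proof.
elim: t => [|t IH] tT; first exact: measurable_cst.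
have mx : measurable_fun setT (fun om : known F (upto t.+1) => x t.+1 om 0 i).
  apply: (measurableT_comp (IH (ltnW tT))).
  by apply: known_sub_measurable => a /=; exact: leqW.
have mv : measurable_fun setT (fun om : known F (upto t.+1) => v t.+1 om 0 i).
  by move=> _ B mB; rewrite setTI; exact: v_measurable.
have E om : x t.+2 om 0 i = x t.+1 om 0 i + (2 / t.+2%:R) * (v t.+1 om 0 i - x t.+1 om 0 i).
  by rewrite xS !mxE.
under eq_fun do rewrite E.
apply: measurable_funD => //; apply: measurable_funM => //.
exact: measurable_funB.
Qed.

Lemma enorm_x_step t om : (t < T)%N ->
  enorm (x t.+2 om - x t.+1 om) <= 2 / t.+2%:R * D.
Proof.
move=> tT; rewrite xS [_ + _ - _]addrC addKr enormZ.
have /andP[e0 _] := eta01 t; rewrite ger0_norm// ler_wpM2l//.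
apply: diameter_ge => //; last exact: x_in_K (ltnW tT).
by have [] := v_argmin om (t := t.+1) tT.
Qed.


Lemma x_known_pred t i : (t <= T)%N ->
  measurable_fun setT (fun om : known F (upto t) => x t om 0 i).
Proof.
case: t => [|t] tT; first exact: measurable_cst.
apply: (measurableT_comp (x_known i (ltnW tT))).
by apply: known_sub_measurable => a /=; exact: leqW.
Qed.

Lemma x_in_K_pred t om : (t <= T)%N -> K (x t om).
Proof. by case: t => [//|t] tT; exact: x_in_K (ltnW tT). Qed.

Lemma Ginf_ge0 : 0 <= Ginf.
Proof. exact: le_trans (normr_ge0 _) (grad_bounded point Kx1). Qed.

(* When the diameter is zero the batch size degenerates to one and the variance
   of the samples is not controlled; but then [K] is a single point. *)
Section PositiveDiameter.
Hypothesis D_gt0 : 0 < D.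

(** Positive dimension is what makes the encoding levels positive. *)
Lemma dim_gt0 : (0 < d)%N.
Proof.
rewrite lt0n; apply/eqP => d0; move: D_gt0; rewrite ltNge => /negP; apply.
apply: sup_le_ub; first by exists (enorm (x1 - x1)); exists x1 => //; exists x1.
move=> _ [y _ [y' _ <-]]; rewrite /enorm /dot big1 ?sqrtr0// => i _.
by exfalso; case: i => i; rewrite d0.
Qed.

Let Mr_gt0 : 0 < M%:R :> R. Proof. by rewrite ltr0n. Qed.
Let dr_gt0 : 0 < d%:R :> R. Proof. by rewrite ltr0n dim_gt0. Qed.
Let p_gt0 i : 0 < (p i)%:R :> R. Proof. by rewrite ltr0n expn_gt0. Qed.

Lemma batch_gt0 t : (0 < t)%N -> (0 < at_round p S t)%N.
Proof.
move=> t0; have [i [k [E _ _ _]]] := period_posE t0.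
rewrite /at_round E /S; case: ifP => _; first by rewrite leq_max.
by apply: nceil_gt0; rewrite divr_gt0.
Qed.

Lemma worker_level_gt0 t : (0 < t)%N -> (0 < at_round p s1 t)%N.
Proof.
move=> t0; have [i [k [E _ _ _]]] := period_posE t0.
by rewrite /at_round E /s1; case: ifP => _; apply: nceil_gt0;
  rewrite sqrtr_gt0 divr_gt0// mulr_gt0// exprn_gt0.
Qed.

Lemma master_level_gt0 t : (0 < t)%N -> (0 < at_round p s2 t)%N.
Proof.
move=> t0; have [i [k [E _ _ _]]] := period_posE t0.
by rewrite /at_round E /s2; case: ifP => _; apply: nceil_gt0;
  rewrite sqrtr_gt0 mulr_gt0// exprn_gt0.
Qed.

Let incr t zeta om := increment p eta x1 v t (grad (ft ^~ zeta)) om.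

Lemma increment_start_le t zeta om : (t <= T)%N -> period_start p t.+1 ->
  `|incr t zeta om| <= Ginf.
Proof.
by move=> tT st; rewrite /incr /increment st; exact: grad_bounded (x_in_K _ tT).
Qed.

Lemma increment_enorm_le t zeta om i k : (t < T)%N ->
  period_pos p t.+2 = (i, k) -> ~~ period_start p t.+2 ->
  enorm (incr t.+1 zeta om) <= 2 * L * D / (p i)%:R.
Proof.
move=> tT E st; rewrite /incr /increment (negbTE st).
have K1 := x_in_K om tT; have K2 := x_in_K om (ltnW tT).
apply: le_trans ((ft_smooth zeta).2 _ _ K1 K2) _.
have -> : 2 * L * D / (p i)%:R = L * (2 / (p i)%:R * D) by field; rewrite gt_eqF.
rewrite ler_wpM2l ?(ltW L_gt0)//; apply: le_trans (enorm_x_step om tT) _.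
rewrite ler_wpM2r ?(ltW D_gt0)// ler_wpM2l// lef_pV2 ?posrE ?ltr0n ?expn_gt0//.
rewrite ler_nat; have [i' [k' [E' k0 _]]] := period_posE (isT : (0 < t.+2)%N).
move: E' k0; rewrite E => -[<- <-] k0 e; move: st k0; rewrite /period_start E /=.
by move: e; generalize (p i) => pi; lia.
Qed.

(** The bound [Ginf + Ginf] on the increments is crude: boundedness suffices for
   measurability. *)
Lemma gbar_known t i : (t <= T)%N ->
  bmeas (fun om : known F (upto t) => gbar t om 0 i).
Proof.
elim: t i => [|t IH] i tT; first by under eq_fun do rewrite mxE; exact: bmeas_cst.
have tT' := ltnW tT.
apply: (@gbar_bmeas _ _ _ _ _ _ _ Pr P K L Ginf ft p S s1 s2 eta x1 z u w v
  M_gt0 L_gt0 ft_smooth grad_unbiased grad_bounded t _ _ _ _ _ _ _ _ (Ginf + Ginf)).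
- exact: batch_gt0.
- exact: worker_level_gt0.
- exact: master_level_gt0.
- by move=> om; exact: x_in_K_pred.
- by move=> om; exact: x_in_K.
- by move=> k; exact: x_known_pred.
- by move=> k; exact: x_known.
- by move=> k; exact: IH.
- move=> zeta om; rewrite /increment; case: ifP => _.
    apply: le_trans (grad_bounded _ (x_in_K om tT')) _; rewrite lerDl; exact: Ginf_ge0.
  apply: le_trans (ler_normB _ _) _; apply: lerD; apply: grad_bounded.
    exact: x_in_K.
  exact: x_in_K_pred.
Qed.

Definition mse t := \sum_(i < d) \int[Pr]_om ((gbar t om - grad f (x t om)) 0 i) ^+ 2.

Lemma mse_round t (delta V : R) : (t < T)%N ->
  (forall zeta om, `|incr t zeta om| <= delta) ->
  (forall m j, \sum_(i < d) \int[Pr]_om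
    (sampling_error (Pr := Pr) P ft p eta x1 (z := z) (u := u) (w := w) v (t := t) i
      (om, z t.+1 m j om)) ^+ 2 <= V) ->
  mse t.+1 <= (if period_start p t.+1 then 0 else mse t)
    + V / (M%:R * (at_round p S t.+1)%:R)
    + d%:R * delta ^+ 2 / (M%:R * (at_round p s1 t.+1)%:R ^+ 2)
    + d%:R * delta ^+ 2 / (at_round p s2 t.+1)%:R ^+ 2.
Proof.
move=> tT incr_le V_le; have tT' := ltnW tT.
have := @round_error _ _ _ _ _ _ _ Pr P K L Ginf ft p S s1 s2 eta x1 z u w v
  M_gt0 L_gt0 ft_smooth f_diff grad_unbiased grad_bounded z_law u_law w_law
  F_independent t (@batch_gt0 t.+1 isT) (@worker_level_gt0 t.+1 isT) (@master_level_gt0 t.+1 isT)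
  (fun om => x_in_K_pred om tT') (fun om => x_in_K om tT')
  (fun i => x_known_pred i tT') (fun i => x_known i tT')
  (fun i => gbar_known i tT') delta incr_le V V_le.
rewrite /mse; congr (_ <= _ + _ + _ + _).
rewrite /previous_error; case: ifP => // _.
rewrite big1// => i _; under eq_Rintegral do rewrite mxE expr0n /=.
exact: mean_cst.
Qed.


Let ler_frac (a b c e : R) : 0 < b -> 0 < e -> a * e <= c * b -> a / b <= c / e.
Proof. by move=> b0 e0 h; rewrite ler_pdivrMr// mulrAC ler_pdivlMr. Qed.

(** The first round of a period is accurate by brute force: batches and levels
    grow like [p_i]^2, resp. [p_i], and each of the three noises is brought down
    to the order of [1 / p_i^2]. *)
Lemma mse_start t i : (t < T)%N -> period_pos p t.+1 = (i, 1%N) ->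
  mse t.+1 <= (L ^+ 2 * D ^+ 2 + 2 * Ginf ^+ 2) / (p i)%:R ^+ 2.
Proof.
move=> tT E; have tT' := ltnW tT.
have st : period_start p t.+1 by rewrite /period_start E.
have q2 : 0 < (p i)%:R ^+ 2 :> R by rewrite exprn_gt0.
have b0 := @batch_gt0 t.+1 isT; have l10 := @worker_level_gt0 t.+1 isT.
have l20 := @master_level_gt0 t.+1 isT.
have := @mse_round t Ginf (sigma ^+ 2) tT
  (fun zeta om => increment_start_le zeta om tT' st).
rewrite st add0r => H; apply: le_trans (H _) _ => {H}.
  move=> m j; exact: (sampling_variance_start L_gt0 ft_smooth f_diff grad_unbiased
    grad_variance grad_bounded z_law F_independent
    (fun om => x_in_K_pred om tT') (fun om => x_in_K om tT')
    (fun i => x_known_pred i tT') (fun i => x_known i tT') m j st).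
have -> : (L ^+ 2 * D ^+ 2 + 2 * Ginf ^+ 2) / (p i)%:R ^+ 2 =
    L ^+ 2 * D ^+ 2 / (p i)%:R ^+ 2 + Ginf ^+ 2 / (p i)%:R ^+ 2
    + Ginf ^+ 2 / (p i)%:R ^+ 2 by field; rewrite gt_eqF.
apply: lerD; first apply: lerD; apply: ler_frac => //.
- by rewrite mulr_gt0// ltr0n.
- have LD : 0 < M%:R * L ^+ 2 * D ^+ 2 by rewrite !mulr_gt0// exprn_gt0.
  have : sigma ^+ 2 * (p i)%:R ^+ 2 / (M%:R * L ^+ 2 * D ^+ 2)
      <= (at_round p S t.+1)%:R.
    rewrite /at_round E /S eqxx; apply: (le_trans (nceil_ge _)).
      by rewrite divr_ge0 ?(ltW LD)// mulr_ge0// sqr_ge0.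
    by rewrite ler_nat leq_maxr.
  by rewrite ler_pdivrMr//; lra.
- by rewrite mulr_gt0// exprn_gt0// ltr0n.
- have : d%:R * (p i)%:R ^+ 2 / M%:R <= (at_round p s1 t.+1)%:R ^+ 2 :> R.
    rewrite /at_round E /s1 eqxx; apply: nceil_sqrt_ge.
    by rewrite divr_ge0// mulr_ge0// sqr_ge0.
  rewrite ler_pdivrMr// => /(ler_wpM2l (sqr_ge0 Ginf)); lra.
- by rewrite exprn_gt0// ltr0n.
- have : d%:R * (p i)%:R ^+ 2 <= (at_round p s2 t.+1)%:R ^+ 2 :> R.
    by rewrite /at_round E /s2 eqxx; apply: nceil_sqrt_ge; rewrite mulr_ge0// sqr_ge0.
  by move=> /(ler_wpM2l (sqr_ge0 Ginf)); lra.
Qed.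

(** Later rounds estimate an increment of size at most [2 L D / p_i], so batches of
    total size [p_i] and levels of order [sqrt p_i] leave [(2 L D)^2 / p_i^3] for
    each of the three noises. *)
Lemma mse_step t i k : (t.+1 < T)%N -> period_pos p t.+2 = (i, k) -> k != 1%N ->
  mse t.+2 <= mse t.+1 + 12 * L ^+ 2 * D ^+ 2 / (p i)%:R ^+ 3.
Proof.
move=> tT E k1; have tT' := ltnW tT.
have st : ~~ period_start p t.+2 by rewrite /period_start E.
pose c : R := 2 * L * D / (p i)%:R.
have incr_le zeta om : enorm (incr t.+1 zeta om) <= c.
  exact: (increment_enorm_le zeta om tT' E st).
have b0 := @batch_gt0 t.+2 isT; have l10 := @worker_level_gt0 t.+2 isT.
have l20 := @master_level_gt0 t.+2 isT.
have := @mse_round t.+1 c (c ^+ 2) tT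
  (fun zeta om => le_trans (norm_le_enorm _) (incr_le zeta om)).
rewrite (negbTE st) => H; apply: le_trans (H _) _ => {H}.
  move=> m j; exact: (sampling_variance_increment L_gt0 ft_smooth f_diff
    grad_unbiased grad_bounded z_law F_independent
    (fun om => x_in_K_pred om tT') (fun om => x_in_K om tT')
    (fun i => x_known_pred i tT') (fun i => x_known i tT') m j incr_le).
have -> : 12 * L ^+ 2 * D ^+ 2 / (p i)%:R ^+ 3 =
    c ^+ 2 / (p i)%:R + c ^+ 2 / (p i)%:R + c ^+ 2 / (p i)%:R.
  by rewrite /c; field; rewrite gt_eqF.
rewrite -!addrA lerD2l.
apply: lerD; last apply: lerD; apply: ler_frac => //.
- by rewrite mulr_gt0// ltr0n.
- rewrite ler_wpM2l ?sqr_ge0// mulrC -ler_pdivrMr//.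
  rewrite /at_round E /S (negbTE k1); apply: nceil_ge; exact: divr_ge0.
- by rewrite mulr_gt0// exprn_gt0// ltr0n.
- have : d%:R * (p i)%:R / M%:R <= (at_round p s1 t.+2)%:R ^+ 2 :> R.
    rewrite /at_round E /s1 (negbTE k1); apply: nceil_sqrt_ge.
    by rewrite divr_ge0// mulr_ge0.
  rewrite ler_pdivrMr// => /(ler_wpM2l (sqr_ge0 c)); lra.
- by rewrite exprn_gt0// ltr0n.
- have : d%:R * (p i)%:R <= (at_round p s2 t.+2)%:R ^+ 2 :> R.
    by rewrite /at_round E /s2 (negbTE k1); apply: nceil_sqrt_ge; rewrite mulr_ge0.
  by move=> /(ler_wpM2l (sqr_ge0 c)); lra.
Qed.

Lemma mse_within_period t i k : (t < T)%N -> period_pos p t.+1 = (i, k) ->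
  mse t.+1 <= (L ^+ 2 * D ^+ 2 + 2 * Ginf ^+ 2) / (p i)%:R ^+ 2
    + k.-1%:R * (12 * L ^+ 2 * D ^+ 2 / (p i)%:R ^+ 3).
Proof.
elim: t i k => [|t IH] i k tT E.
  move: E => [<- <-]; rewrite mul0r addr0; exact: mse_start.
have [i' [k' [E' k0 k'p _]]] := period_posE (isT : (0 < t.+1)%N).
have := E; rewrite -[period_pos p t.+2]/(let: (i, k) := period_pos p t.+1 in
  if (k < p i)%N then (i, k.+1) else (i.+1, 1%N)) E'.
case: ifP => kp [ei ek]; last first.
  by rewrite -ek mul0r addr0; apply: mse_start => //; rewrite E -ek.
have k1 : k != 1%N by rewrite -ek eqSS -lt0n.
apply: le_trans (mse_step tT E k1) _.
have := IH _ _ (ltnW tT) E'; rewrite ei -ek /=.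
have -> : k'%:R = k'.-1%:R + 1 :> R by rewrite natr1 prednK.
rewrite [(k'.-1%:R + 1) * _]mulrDl mul1r.
by move=> h; rewrite addrA lerD2r.
Qed.

Let C0 := Num.sqrt (13 * L ^+ 2 * D ^+ 2 + 2 * Ginf ^+ 2).

Lemma C0_gt0 : 0 < C0.
Proof.
rewrite sqrtr_gt0 ltr_pwDl//; first by rewrite !mulr_gt0// exprn_gt0.
by rewrite mulr_ge0// sqr_ge0.
Qed.

(** At most [p_i] rounds of a period contribute [12 L^2 D^2 / p_i^3] each, which
    with the [L^2 D^2] of the first round gives the constant 13. *)
Lemma mse_le t : (0 < t <= T)%N -> mse t <= (2 * C0 / t.+1%:R) ^+ 2.
Proof.
case: t => // t /= tT.
have [i [k [E k0 kp e]]] := period_posE (isT : (0 < t.+1)%N).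
have qp := p_gt0 i.
apply: (@le_trans _ _ ((C0 / (p i)%:R) ^+ 2)); last first.
  rewrite lerXn2r ?nnegrE ?divr_ge0 ?mulr_ge0 ?(ltW C0_gt0)//.
  rewrite ler_pdivrMr// mulrAC ler_pdivlMr ?ltr0n//.
  have : (t.+2)%:R <= 2 * (p i)%:R :> R.
    by rewrite -natrM ler_nat -e mul2n -addnn leq_add2l.
  by move=> /(ler_wpM2l (ltW C0_gt0)); lra.
apply: le_trans (mse_within_period tT E) _.
rewrite expr_div_n sqr_sqrtr; last by rewrite ltW// -sqrtr_gt0 C0_gt0.
have kpR : k.-1%:R <= (p i)%:R :> R by rewrite ler_nat (leq_trans (leq_pred _) kp).
have h : 0 <= 12 * L ^+ 2 * D ^+ 2 / (p i)%:R ^+ 3.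
  by rewrite divr_ge0 ?exprn_ge0 ?(ltW qp)// -mulrA -exprMn mulr_ge0// sqr_ge0.
apply: le_trans (lerD (lexx _) (ler_wpM2r h kpR)) _.
rewrite le_eqVlt; apply/orP; left; apply/eqP; field; rewrite gt_eqF//.
Qed.


Let Fm := @source_sigma_measurable _ _ _ _ _ _ _ Pr z u w.
Let Kstar : K xstar. Proof. by case: xstar_min. Qed.
Let f_convex := objective_convex K_convex ft_convex ft_integrable.
Let f_smooth := objective_smooth L_gt0 ft_smooth f_diff grad_unbiased grad_bounded.
Let f_lipschitz := objective_lipschitz K_convex ft_convex ft_integrable f_diff
  grad_unbiased grad_bounded.

Lemma objective_bmeas t : (t <= T)%N -> bmeas (fun om => f (x t.+1 om)).
Proof.
move=> tT; split; last first.
  exists (`|f xstar| + d%:R * Ginf * D) => om.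
  have := f_lipschitz (x_in_K om tT) Kstar => h.
  rewrite -[f (x t.+1 om)](subrK (f xstar)) addrC.
  apply: le_trans (ler_normD _ _) _; rewrite lerD2l; apply: le_trans h _.
  rewrite ler_wpM2l ?mulr_ge0 ?Ginf_ge0//; apply: le_trans (norm_le_enorm _) _.
  exact: diameter_ge (x_in_K om tT) Kstar.
have H := @lipschitz_joint_measurable _ _ _ (known F (upto t)) unit d K
  (d%:R * Ginf) (x t.+1) (fun y _ => f y) (fun om => x_in_K om tT)
  (fun i => x_known i tT).
have mp : measurable_fun setT (fun om : Omega => (om : known F (upto t), tt)).
  apply: measurable_fun_pair; last exact: measurable_cst.
  exact: known_id_measurable.
apply: (measurableT_comp (H _ _) mp); last by move=> y _; exact: measurable_cst.
by move=> y1 y2 _; exact: f_lipschitz.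
Qed.

Lemma estimation_error_bmeas t i : (t <= T)%N ->
  bmeas (fun om => (gbar t om - grad f (x t om)) 0 i).
Proof.
move=> tT; have E om : (gbar t om - grad f (x t om)) 0 i =
    gbar t om 0 i - grad f (x t om) 0 i by rewrite mxE [X in _ + X]mxE.
under eq_fun do rewrite E; apply: bmeasB; apply: (known_bmeas Fm).
  exact: gbar_known.
apply: (fgrad_at_bmeas L_gt0 ft_smooth f_diff grad_unbiased grad_bounded) => // [om|j].
  exact: x_in_K_pred.
exact: x_known_pred.
Qed.

Lemma mse_enorm t : (t <= T)%N ->
  \int[Pr]_om enorm (gbar t om - grad f (x t om)) ^+ 2 = mse t.
Proof.
move=> tT; rewrite /mse -mean_sum.
  by apply: eq_Rintegral => om _; rewrite enorm_sqr_sum.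
by move=> i; apply: bmeasX; exact: estimation_error_bmeas.
Qed.

Lemma enorm_error_bmeas t : (t <= T)%N ->
  bmeas (fun om => enorm (gbar t om - grad f (x t om)) ^+ 2).
Proof.
move=> tT; under eq_fun do rewrite enorm_sqr_sum.
by apply: bmeas_sum => i; apply: bmeasX; exact: estimation_error_bmeas.
Qed.

Let gap t := \int[Pr]_om (f (x t om) - f xstar).

Lemma gap_step t : (0 < t <= T)%N ->
  t%:R * t.+1%:R * gap t.+1 <= t.-1%:R * t%:R * gap t
    + (4 * D * C0 + 2 * L * D ^+ 2).
Proof.
case: t => // t /= tT; have tT' := ltnW tT.
set e : R := 2 / t.+2%:R; set c := 2 * C0 / t.+2%:R.
have t2 : 0 < t.+2%:R :> R by rewrite ltr0n.
have c0 : 0 < c by rewrite divr_gt0// mulr_gt0// C0_gt0.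
have [e0 e1] := andP (eta01 t); rewrite -/e in e0 e1.
have bgap s : (s <= T)%N -> bmeas (fun om => f (x s.+1 om) - f xstar).
  by move=> sT; apply: bmeasB; [exact: objective_bmeas|exact: bmeas_cst].
have berr := enorm_error_bmeas tT.
have step : gap t.+2 <= (1 - e) * gap t.+1
    + e * D * (c^-1 * mse t.+1 + c) / 2 + L * e ^+ 2 * D ^+ 2 / 2.
  apply: (@le_trans _ _ (\int[Pr]_om ((1 - e) * (f (x t.+1 om) - f xstar)
      + (e * D / 2 / c) * enorm (gbar t.+1 om - grad f (x t.+1 om)) ^+ 2
      + (e * D * c / 2 + L * e ^+ 2 * D ^+ 2 / 2)))).
    apply: mean_mono => [||om]; first exact: bgap.
      apply: bmeasD; last exact: bmeas_cst.
      by apply: bmeasD; apply: bmeasZ => //; exact: bgap.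
    have h := frank_wolfe_step K_convex K_compact f_convex f_smooth (ltW L_gt0)
      (x_in_K om tT') Kstar (v_argmin om (t := t.+1) tT) (eta01 t) c0.
    rewrite xS -/e; apply: le_trans h _.
    have regroup (a N b : R) : (1 - e) * a + e * D * (c^-1 * N + c) / 2 + b =
        (1 - e) * a + (e * D / 2 / c) * N + (e * D * c / 2 + b).
      by field; rewrite gt_eqF.
    by rewrite regroup.
  have b1 := bmeasZ (1 - e) (bgap _ tT'); have b2 := bmeasZ (e * D / 2 / c) berr.
  rewrite (mean_add _ (bmeasD b1 b2) (bmeas_cst _ _)) (mean_add _ b1 b2).
  rewrite (mean_scale _ _ (bgap _ tT')) (mean_scale _ _ berr) mean_cst mse_enorm//.
  rewrite -/(gap t.+1) le_eqVlt; apply/orP; left; apply/eqP; field.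
  by rewrite gt_eqF.
(* The weight [c] is the bound on the root mean square error, which balances the
   two terms of the arithmetic-geometric inequality. *)
have h2 : c^-1 * mse t.+1 <= c.
  by rewrite ler_pdivrMl// -expr2; exact: mse_le.
have h3 : gap t.+2 <= (1 - e) * gap t.+1 + e * D * c + L * e ^+ 2 * D ^+ 2 / 2.
  apply: le_trans step _; rewrite lerD2r lerD2l -mulrA ler_wpM2l//.
    by rewrite mulr_ge0// ltW.
  by lra.
have tt : 0 < t.+1%:R * t.+2%:R :> R by rewrite mulr_gt0// ltr0n.
apply: le_trans (ler_wpM2l (ltW tt) h3) _.
set B := 4 * D * C0 + 2 * L * D ^+ 2.
have -> : t.+1%:R * t.+2%:R * ((1 - e) * gap t.+1 + e * D * c + L * e ^+ 2 * D ^+ 2 / 2)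
    = t%:R * t.+1%:R * gap t.+1 + B * (t.+1%:R / t.+2%:R).
  rewrite /e /c /B -[t.+2%:R]natr1 -[t.+1%:R]natr1; field.
  by rewrite gt_eqF//; have := ler0n R t; lra.
rewrite lerD2l -[leRHS]mulr1 ler_wpM2l//.
  by rewrite addr_ge0// !mulr_ge0// ?sqr_ge0// ?(ltW C0_gt0)// ltW.
by rewrite ler_pdivrMr// mul1r ler_nat.
Qed.

Lemma gap_le : (0 < T)%N -> gap T.+1 <= (4 * D * C0 + 2 * L * D ^+ 2) / T%:R.
Proof.
move=> T0; apply: weighted_recursion => //; last exact: gap_step.
by rewrite addr_ge0// !mulr_ge0// ?sqr_ge0// ?(ltW C0_gt0)// ltW.
Qed.

Lemma expected_gap : (0 < T)%N ->
  ('E_Pr[fun om => f (x T.+1 om)] - (f xstar)%:E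
    <= ((4 * D * C0 + 2 * L * D ^+ 2) / T%:R)%:E)%E.
Proof.
move=> T0; have bf := objective_bmeas (leqnn T).
rewrite unlock -[X in (X - _)%E]fineK; last first.
  exact: (integrable_fin_num measurableT (bmeas_integrable Pr bf)).
rewrite -EFinB lee_fin; apply: le_trans (gap_le T0).
rewrite /gap mean_sub//; last exact: bmeas_cst.
by rewrite mean_cst.
Qed.

End PositiveDiameter.

End Rate.

Theorem theorem6 (R : realType) (d q M T : nat)
    (* the problem *)
    (K : set 'rV[R]_d) (L sigma Ginf : R)
    (P : probability (q.-tuple R) R)
    (ft : 'rV[R]_d -> q.-tuple R -> R)
    (x1 xstar : 'rV[R]_d)
    (* the probability space of a run of the algorithm *)
    (dO : measure_display) (Omega : measurableType dO)
    (Pr : probability Omega R)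
    (z : nat -> 'I_M -> nat -> {RV Pr >-> q.-tuple R})
    (u : nat -> 'I_M -> 'I_d -> {RV Pr >-> R})
    (w : nat -> 'I_d -> {RV Pr >-> R})
    (v : nat -> Omega -> 'rV[R]_d) :
  let f := fun x : 'rV[R]_d => fine ('E_P[ft x])%E in
  let D := diameter K in
  let p := fun i : nat => (2 ^ i.-1)%N in
  let S := fun i k : nat =>
    if k == 1%N
    then maxn 1 (nceil (sigma ^+ 2 * (p i)%:R ^+ 2
                        / (M%:R * L ^+ 2 * D ^+ 2)))
    else nceil ((p i)%:R / M%:R : R) in
  let s1 := fun i k : nat =>
    if k == 1%N then nceil (Num.sqrt (d%:R * (p i)%:R ^+ 2 / M%:R : R))
    else nceil (Num.sqrt (d%:R * (p i)%:R / M%:R : R)) in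
  let s2 := fun i k : nat =>
    if k == 1%N then nceil (Num.sqrt (d%:R * (p i)%:R ^+ 2 : R))
    else nceil (Num.sqrt (d%:R * (p i)%:R : R)) in
  let eta := fun i k : nat => 2 / ((p i)%:R + k%:R) : R in
  let F := source_sigma z u w in
  let x := fun (t : nat) (om : Omega) =>
    qfw_x p eta x1 (fun t' => v t' om) t in
  let gbar := fun (t : nat) (om : Omega) =>
    grad_est ft p S s1 s2 eta x1
      (fun t' m j => z t' m j om) (fun t' m i => u t' m i om)
      (fun t' i => w t' i om) (fun t' => v t' om) t in
  (0 < M)%N -> (0 < T)%N -> 0 < L ->
  convex_set K -> compact K ->
  (* assumptions on the stochastic functions *)
  (forall zeta, convex_function K (ft ^~ zeta)) ->
  (forall zeta, smooth_on K L (ft ^~ zeta)) ->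
  (forall y, K y -> P.-integrable setT (EFin \o ft y)) ->
  (forall y, K y -> differentiable f y) ->
  (forall y i, K y ->
    P.-integrable setT (fun zeta => (grad (ft ^~ zeta) y 0 i)%:E) /\
    ('E_P[fun zeta => (grad (ft ^~ zeta) y 0 i)%R] = (grad f y 0 i)%R%:E)%E) ->
  (forall y, K y ->
    ('E_P[fun zeta => (enorm (grad (ft ^~ zeta) y - grad f y) ^+ 2)%R]
      <= (sigma ^+ 2)%:E)%E) ->
  (forall y zeta, K y -> `|grad (ft ^~ zeta) y| <= Ginf) ->
  K x1 -> is_argmin K f xstar ->
  (* the random choices *)
  (forall t m j (B : set (q.-tuple R)), measurable B ->
    distribution Pr (z t m j) B = P B) ->
  (forall t m i (B : set R), measurable B ->
    distribution Pr (u t m i) B = uniform_prob (@ltr01 R) B) ->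
  (forall t i (B : set R), measurable B ->
    distribution Pr (w t i) B = uniform_prob (@ltr01 R) B) ->
  mutually_independent Pr F ->
  (* the linear minimization steps *)
  (forall t om, (0 < t <= T)%N ->
    is_argmin K (fun y => dot y (gbar t om)) (v t om)) ->
  (forall t, (0 < t <= T)%N -> history_measurable (history F t) (v t)) ->
  (forall om, K (x T.+1 om)) /\
  ('E_Pr[fun om => f (x T.+1 om)] - (f xstar)%:E
    <= ((4 * D * Num.sqrt (13 * L ^+ 2 * D ^+ 2 + 2 * Ginf ^+ 2)
         + 2 * L * D ^+ 2) / T%:R)%:E)%E.
Proof.
move=> f D p S s1 s2 eta F x gbar M0 T0 L0 cK compK ft_convex ft_smooth ft_int
  f_diff unbiased variance bounded Kx1 xstar_min z_law u_law w_law indep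
  v_argmin v_meas.
have xK om : K (x T.+1 om).
  exact: (x_in_K cK Kx1 v_argmin om (leqnn T)).
split=> //.
have Kstar : K xstar by case: xstar_min.
have [D0|D0] := ltP 0 D.
  exact: (expected_gap M0 L0 cK compK ft_convex ft_smooth ft_int f_diff unbiased
    variance bounded Kx1 xstar_min z_law u_law w_law indep v_argmin v_meas D0 T0).
have {}D0 : D = 0.
  apply/eqP; rewrite eq_le D0 (le_trans (enorm_ge0 (x1 - x1)))//.
  exact: diameter_ge.
have xE om : x T.+1 om = xstar.
  apply/eqP; rewrite -subr_eq0; apply/eqP/enorm_eq0/eqP.
  rewrite eq_le enorm_ge0 andbT -D0; exact: diameter_ge.
have -> : (fun om => f (x T.+1 om)) = cst (f xstar).
  by apply/funext => om; rewrite xE.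
rewrite expectation_cst -EFinB subrr lee_fin.
by rewrite D0 expr0n /= !(mulr0, mul0r) addr0 mul0r.
Qed.
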